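(* Let $N\ge 2$, $s\in(0,1)$, and let $a\in L^\infty(\mathbb{S}^{N-1})$ be an even function for which there exist constants $0<d<D$, a vector $\nu_0\in\mathbb{S}^{N-1}$ and $\tau_0\in(0,1]$ such that $0\le a(\theta)\le D$ in $\mathbb{S}^{N-1}$ and $a(\theta)\ge d$ in $\Sigma_{\nu_0,\tau_0}(0)\cap\mathbb{S}^{N-1}$. Let $L$ be the operator $$Lu(x)=\int_{\mathbb{R}^N}\frac{u(x+y)+u(x-y)-2u(x)}{|y|^{N+2s}}\,a\!\left(\frac{y}{|y|}\right)dy .$$ Let $1\le p\le\frac{N}{N-2s}$. If $u\in C^2(\mathbb{R}^N)\cap\mathcal{L}_s$ is nonnegative and satisfies $-Lu(x)\ge u(x)^p$ for all $x\in\mathbb{R}^N$, then $u\equiv 0$.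
   Context: ''Even'' means $a(-\theta)=a(\theta)$. For $\nu\in\mathbb{S}^{N-1}$, $\tau\in(0,1]$ and $x\in\mathbb{R}^N$, the closed two-fold cone is $$\Sigma_{\nu,\tau}(x)=\{y\in\mathbb{R}^N:\ |(y-x)\cdot\nu|\ge(1-\tau)|y-x|\}.$$ The function space is $$\mathcal{L}_s=\left\{u\in L^1_{loc}(\mathbb{R}^N):\ \limsup_{|x|\to+\infty}\frac{|u(x)|}{|x|^{2s-\delta}}<+\infty\ \text{ for some }\delta\in(0,2s]\right\}.$$ *)

(* Defs.v *)
From HB Require Import structures.
From mathcomp Require Import all_boot all_order all_algebra.
From mathcomp Require Import all_classical all_reals all_analysis.
From mathcomp Require Import measurable_realfun.

Set Implicit Arguments.
Unset Strict Implicit.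
Unset Printing Implicit Defensive.

Import Order.TTheory GRing.Theory Num.Theory.
Import numFieldNormedType.Exports.

Local Open Scope classical_set_scope.
Local Open Scope ring_scope.

(* The canonical norm [`|x|] of 'rV[R]_n is the sup norm; it is used below only
   through the topology it induces, lengths being measured by [enorm]. *)

Definition dotr (R : realType) (n : nat) (x y : 'rV[R]_n) : R :=
  \sum_(i < n) x 0 i * y 0 i.

Definition enorm (R : realType) (n : nat) (x : 'rV[R]_n) : R :=
  Num.sqrt (dotr x x).

Definition sphere (R : realType) (n : nat) : set 'rV[R]_n :=
  [set x | enorm x = 1].

Definition cone (R : realType) (n : nat) (nu : 'rV[R]_n) (tau : R)
    (x : 'rV[R]_n) : set 'rV[R]_n :=
  [set y | (1 - tau) * enorm (y - x) <= `|dotr (y - x) nu|].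

Definition rV_borel_display : measure_display.
Proof. exact: default_measure_display. Qed.

Section borel_rV.
Context (R : realType) (n : nat).

Let borel : set (set 'rV[R]_n) := <<s open >>.

Let borel0 : borel set0.
Proof. exact: sigma_algebra0. Qed.

Let borelC A : borel A -> borel (~` A).
Proof. exact: sigma_algebraC. Qed.

Let borel_bigcup (F : (set 'rV[R]_n)^nat) :
  (forall i, borel (F i)) -> borel (\bigcup_i F i).
Proof. exact: sigma_algebra_bigcup. Qed.

HB.instance Definition _ := @isMeasurable.Build rV_borel_display
  'rV[R]_n borel borel0 borelC borel_bigcup.

End borel_rV.

Section measurable_rV_theory.
Context (R : realType).

Lemma open_measurable_rV n (A : set 'rV[R]_n) : open A -> measurable A.
Proof. exact: sub_sigma_algebra. Qed.

Lemma measurable_coord_rV n (i : 'I_n) :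
  measurable_fun setT (fun x : 'rV[R]_n => x 0 i).
Proof.
apply: (measurability _ (RGenOpens.measurableE R)) => //.
move=> _ [_ [a [b ->] <-]]; rewrite setTI; apply: open_measurable_rV.
have /continuousP := @coord_continuous R 1 n 0 i; apply.
exact: interval_open.
Qed.

Lemma measurable_rVP d (T : measurableType d) n (f : T -> 'rV[R]_n) :
  (forall i, measurable_fun setT (fun t => f t 0 i)) -> measurable_fun setT f.
Proof.
move=> mf; apply: (measurability (open : set (set 'rV[R]_n))) => //.
move=> _ [U oU <-]; rewrite setTI.
pose box (p : 'rV[rat]_n * nat) : set 'rV[R]_n :=
  [set y | forall i, `|y 0 i - ratr (p.1 0 i)| < p.2.+1%:R^-1].
pose B k := if @unpickle ('rV[rat]_n * nat)%type k is Some p then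
  (if `[< box p `<=` U >] then f @^-1` box p else set0) else set0.
have -> : f @^-1` U = \bigcup_k B k.
  apply/seteqP; split=> [t /= Uft|t [k _]]; last first.
    by rewrite /B; case: unpickle => // p; case: asboolP => // + Bt; apply.
  have [e /= e0 eU] : nbhs_ball (f t) U by apply/nbhs_ballP; exact: oU.
  have [k ke] : exists k, k.+1%:R^-1 < e / 2 :> R.
    have /ltr_add_invr[k] : 0 < e / 2 by rewrite divr_gt0.
    by rewrite add0r => ?; exists k.
  have rat_near i : {q : rat | `|f t 0 i - ratr q| < k.+1%:R^-1}.
    apply: cid; have /rat_in_itvoo[q] : f t 0 i - k.+1%:R^-1 < f t 0 i + k.+1%:R^-1.
      by rewrite ltrD2l gtrN // invr_gt0.
    rewrite in_itv /= => /andP[q1 q2]; exists q.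
    by rewrite ltr_distlC q1.
  pose q : 'rV[rat]_n := \row_i projT1 (rat_near i).
  exists (pickle (q, k)) => //; rewrite /B pickleK.
  have qU : box (q, k) `<=` U.
    move=> y yq; apply: eU; split => // i j; rewrite ord1.
    rewrite /ball /= -(subrK (ratr (q 0 j)) (f t 0 j)) -addrA.
    rewrite (le_lt_trans (ler_normD _ _))// (splitr e) ltrD //.
      by rewrite (lt_trans _ ke)// mxE; exact: (projT2 (rat_near j)).
    by rewrite (lt_trans _ ke)// distrC; exact: yq.
  rewrite asboolT // => i /=; rewrite mxE; exact: (projT2 (rat_near i)).
apply: bigcupT_measurable => k; rewrite /B; case: unpickle => // p.
case: ifP => // _.
rewrite (_ : _ @^-1` _ = \bigcap_(i in [set: 'I_n])
    ((fun t => f t 0 i) @^-1` [set y | `|y - ratr (p.1 0 i)| < p.2.+1%:R^-1])).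
  apply: fin_bigcap_measurable => // i _; rewrite -[X in measurable X]setTI.
  apply: mf => //; rewrite [X in measurable X](_ : _ =
      `]ratr (p.1 0 i) - p.2.+1%:R^-1, ratr (p.1 0 i) + p.2.+1%:R^-1[%classic).
    exact: measurable_itv.
  by apply/seteqP; split => y /=; rewrite in_itv/= ltr_distl.
by apply/seteqP; split=> [t/= h i _|t/= h i]; [exact: h|exact: h].
Qed.

End measurable_rV_theory.

Section cons_rV.
Context (R : realType).

Definition cons_rV n (p : measurableTypeR R * 'rV[R]_n) : 'rV[R]_n.+1 :=
  row_mx (p.1%:M : 'rV[R]_1) p.2.

Lemma cons_rV0 n (p : measurableTypeR R * 'rV[R]_n) : cons_rV p 0 ord0 = p.1.
Proof.
rewrite /cons_rV mxE; case: splitP => //= j _.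
by rewrite !ord1 mxE eqxx mulr1n.
Qed.

Lemma cons_rVS n (p : measurableTypeR R * 'rV[R]_n) i :
  cons_rV p 0 (lift ord0 i) = p.2 0 i.
Proof.
rewrite /cons_rV mxE; case: splitP => [j|j /=]; first by rewrite !ord1.
by rewrite /bump leq0n => /addnI/val_inj ->.
Qed.

Lemma measurable_cons_rV n : measurable_fun setT (@cons_rV n).
Proof.
apply: measurable_rVP => i; have [j ->|->] := unliftP ord0 i.
  under eq_fun do rewrite cons_rVS.
  exact: (measurableT_comp (measurable_coord_rV j)).
under eq_fun do rewrite cons_rV0.
exact: measurable_fst.
Qed.

Definition uncons_rV n (x : 'rV[R]_n.+1) : measurableTypeR R * 'rV[R]_n :=
  (x 0 ord0, \row_i x 0 (lift ord0 i)).

Lemma measurable_uncons_rV n : measurable_fun setT (@uncons_rV n).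
Proof.
apply: measurable_fun_pair; first exact: measurable_coord_rV.
apply: measurable_rVP => i; under eq_fun do rewrite mxE.
exact: measurable_coord_rV.
Qed.

Lemma cons_rVK n : cancel (@cons_rV n) (@uncons_rV n).
Proof.
move=> [x v]; rewrite /uncons_rV cons_rV0; congr pair.
by apply/rowP => i; rewrite mxE cons_rVS.
Qed.

Lemma uncons_rVK n : cancel (@uncons_rV n) (@cons_rV n).
Proof.
move=> x; apply/rowP => i; have [j ->|->] := unliftP ord0 i.
  by rewrite cons_rVS mxE.
by rewrite cons_rV0.
Qed.

End cons_rV.

(* Cavalieri's principle: the slice of [A] at first coordinate [x] is
   [set v | A (row_mx x%:M v)]. *)
Fixpoint lebesgue_rV (R : realType) (n : nat) : set 'rV[R]_n -> \bar R :=
  match n return set 'rV[R]_n -> \bar R with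
  | 0 => fun A => \d_(0 : 'rV[R]_0) A
  | m.+1 => fun A => (\int[@lebesgue_measure R]_x
      lebesgue_rV [set v : 'rV[R]_m | A (row_mx (x%:M : 'rV[R]_1) v)])%E
  end.

Section sigma_finite_bundle.
Context d (T : measurableType d) (R : realType) (m : set T -> \bar R).
Context (m0 : m set0 = 0) (m_ge0 : forall A, (0 <= m A)%E)
  (m_add : semi_sigma_additive m) (m_sf : sigma_finite setT m).

Let mu := m.
HB.instance Definition _ := isMeasure.Build _ _ _ mu m0 m_ge0 m_add.
HB.instance Definition _ := Measure_isSigmaFinite.Build _ _ _ mu m_sf.

Lemma sigma_finite_bundle :
  exists nu : {sigma_finite_measure set T -> \bar R}, m = nu.
Proof. by exists mu. Qed.

End sigma_finite_bundle.

Section lebesgue_rV_measure.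

Let product_sigma_finite d1 d2 (T1 : measurableType d1)
    (T2 : measurableType d2) (R : realType)
    (m1 : {sigma_finite_measure set T1 -> \bar R})
    (m2 : {sigma_finite_measure set T2 -> \bar R}) :
  sigma_finite setT (m1 \x m2)%E.
Proof.
have /sigma_finiteP[F [TF ndF Foo]] := sigma_finiteT m1.
have /sigma_finiteP[G [TG ndG Goo]] := sigma_finiteT m2.
exists (fun n => F n `*` G n) => [|k].
  rewrite -setXTT TF TG predeqE => -[x y]; split=> [[/= [i _ Fx] [k _ Gy]]|].
    exists (maxn i k) => //; split.
    - by move: x Fx; exact/subsetPset/ndF/leq_maxl.
    - by move: y Gy; exact/subsetPset/ndG/leq_maxr.
  by move=> [i _ []/= ? ?]; split; exists i.
have [? ?] := Foo k; have [? ?] := Goo k.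
split; first exact: measurableX.
by rewrite product_measure1E// lte_mul_pinfty// ge0_fin_numE.
Qed.

Context (R : realType).

Let lebesgue_rVS_subproof n (mu : {sigma_finite_measure set 'rV[R]_n -> \bar R}) :
  @lebesgue_rV R n = mu ->
  forall A, lebesgue_rV A = (lebesgue_measure \x mu)%E (@cons_rV R n @^-1` A).
Proof.
move=> mun A /=; rewrite mun /product_measure1; apply: eq_integral => x _ /=.
congr (mu _); rewrite /xsection; apply/seteqP; split => v /=; by rewrite inE.
Qed.

Let lebesgue_rV_sigma_finite n :
  exists mu : {sigma_finite_measure set 'rV[R]_n -> \bar R},
    @lebesgue_rV R n = mu.
Proof.
elim: n => [|n [mu mun]].
  by exists (@dirac _ 'rV[R]_0 0 R).
have munS := lebesgue_rVS_subproof mun.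
pose nu := @lebesgue_rV R n.+1.
have mpre A : measurable A -> measurable (@cons_rV R n @^-1` A).
  by move=> mA; rewrite -[X in measurable X]setTI; exact: measurable_cons_rV.
have nu0 : nu set0 = 0 by rewrite /nu munS preimage_set0 measure0.
have nu_ge0 A : (0 <= nu A)%E by rewrite /nu munS.
have nu_add : semi_sigma_additive nu.
  move=> F mF tF mUF; rewrite /nu munS preimage_bigcup.
  under eq_fun do under eq_bigr do rewrite munS.
  apply: measure_semi_sigma_additive.
  - by move=> i; exact: mpre.
  - apply/trivIsetP => /= i j _ _ ij; rewrite -preimage_setI.
    by move/trivIsetP : tF => /(_ _ _ _ _ ij) ->//; rewrite preimage_set0.
  - by rewrite -preimage_bigcup; exact: mpre.
have nu_sf : sigma_finite setT nu.
  have [F FT Foo] := product_sigma_finite (@lebesgue_measure R) mu.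
  exists (fun k => @uncons_rV R n @^-1` F k) => [|k].
    by rewrite -preimage_bigcup -FT preimage_setT.
  have [mFk Fkoo] := Foo k; split.
    by rewrite -[X in measurable X]setTI; exact: measurable_uncons_rV.
  rewrite /nu munS (_ : _ @^-1` _ = F k)//.
  by apply/seteqP; split => p /=; rewrite cons_rVK.
exact: (sigma_finite_bundle nu0 nu_ge0 nu_add nu_sf).
Qed.

Context (n : nat).

Let lebesgue_rV0 : @lebesgue_rV R n set0 = 0.
Proof.
by have [mu ->] := lebesgue_rV_sigma_finite n; rewrite measure0.
Qed.

Let lebesgue_rV_ge0 A : (0 <= @lebesgue_rV R n A)%E.
Proof. by have [mu ->] := lebesgue_rV_sigma_finite n. Qed.

Let lebesgue_rV_sigma_additive : semi_sigma_additive (@lebesgue_rV R n).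
Proof.
have [mu ->] := lebesgue_rV_sigma_finite n.
exact: measure_semi_sigma_additive.
Qed.

HB.instance Definition _ := isMeasure.Build _ _ _ (@lebesgue_rV R n)
  lebesgue_rV0 lebesgue_rV_ge0 lebesgue_rV_sigma_additive.

Let lebesgue_rV_sf : sigma_finite setT (@lebesgue_rV R n).
Proof.
have [mu ->] := lebesgue_rV_sigma_finite n.
exact: sigma_finiteT.
Qed.

HB.instance Definition _ := Measure_isSigmaFinite.Build _ _ _
  (@lebesgue_rV R n) lebesgue_rV_sf.

End lebesgue_rV_measure.

Section lebesgue_rV_theory.
Context (R : realType).
Local Open Scope ereal_scope.

Lemma lebesgue_rVS n (A : set 'rV[R]_n.+1) :
  lebesgue_rV A = (@lebesgue_measure R \x @lebesgue_rV R n) (@cons_rV R n @^-1` A).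
Proof.
rewrite /= /product_measure1; apply: eq_integral => x _ /=.
by congr (lebesgue_rV _); rewrite /xsection; apply/seteqP; split => v /=;
  rewrite inE.
Qed.

Lemma lebesgue_rV_box n (A : 'I_n -> set (measurableTypeR R)) :
  (forall i, measurable (A i)) ->
  lebesgue_rV [set v : 'rV[R]_n | forall i, A i (v 0%R i)] =
  \prod_(i < n) lebesgue_measure (A i).
Proof.
elim: n A => [|n IH] A mA.
  rewrite big_ord0 /= (_ : [set _ | _] = setT) ?diracT//.
  by apply/seteqP; split => // v _ [].
rewrite lebesgue_rVS big_ord_recl.
pose B := [set v : 'rV[R]_n | forall i, A (lift ord0 i) (v 0%R i)].
rewrite (_ : _ @^-1` _ = A ord0 `*` B); last first.
  apply/seteqP; split => [p /= Ap|p [/= A0 Bp] i].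
    split; first by have := Ap ord0; rewrite cons_rV0.
    by move=> i; have := Ap (lift ord0 i); rewrite cons_rVS.
  by have [j ->|->] := unliftP ord0 i; rewrite ?cons_rVS ?cons_rV0.
have mB : measurable B.
  rewrite /B (_ : [set _ | _] = \bigcap_(i in [set: 'I_n])
      ((fun v : 'rV[R]_n => v 0%R i) @^-1` A (lift ord0 i))).
    apply: fin_bigcap_measurable => // i _; rewrite -[X in measurable X]setTI.
    exact: (measurable_coord_rV i measurableT (mA (lift ord0 i))).
  by apply/seteqP; split=> [t/= h i _|t/= h i]; exact: h.
by rewrite product_measure1E// -IH.
Qed.

Lemma measurable_enorm n : measurable_fun setT (@enorm R n).
Proof.
apply: measurableT_comp.
  exact: (continuous_measurable_fun (@sqrt_continuous R)).
apply: measurable_sum => i.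
by apply: measurable_funM; exact: measurable_coord_rV.
Qed.

Lemma measurable_direction n :
  measurable_fun setT (fun x : 'rV[R]_n => (enorm x)^-1 *: x)%R.
Proof.
apply: measurable_rVP => i.
rewrite (_ : (fun x => _) = (fun x : 'rV[R]_n => (enorm x `^ (-1) * x 0 i)%R)).
  apply: measurable_funM; last exact: measurable_coord_rV.
  apply: (measurableT_comp (measurable_powR (-1))); exact: measurable_enorm.
by apply/funext => x; rewrite mxE powR_inv1 ?sqrtr_ge0.
Qed.

End lebesgue_rV_theory.

(* The surface measure of the unit sphere, as a measure on 'rV[R]_n: in polar
   coordinates the volume of the cone {r theta | 0 < r <= 1, theta \in A} is
   1/n times the area of A. *)
Definition surface_measure (R : realType) (n : nat) (A : set 'rV[R]_n)
    : \bar R :=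
  (n%:R%:E * lebesgue_rV [set x | (0 < enorm x <= 1)%R /\
                                  A ((enorm x)^-1 *: x)%R])%E.

Section surface_measure.
Context (R : realType) (n : nat).
Local Open Scope ereal_scope.

Let ball1 : set 'rV[R]_n := [set x | (0 < enorm x <= 1)%R].
Let dir (x : 'rV[R]_n) : 'rV[R]_n := ((enorm x)^-1 *: x)%R.
Let nu (A : set 'rV[R]_n) := lebesgue_rV (ball1 `&` dir @^-1` A).

Let surfaceE A : surface_measure A = n%:R%:E * nu A.
Proof. by []. Qed.

Let mball1 : measurable ball1.
Proof.
rewrite (_ : ball1 = @enorm R n @^-1` `]0%R, 1%R]); last first.
  by apply/seteqP; split => x /=; rewrite in_itv.
by rewrite -[X in measurable X]setTI; exact: measurable_enorm.
Qed.

Let mcone A : measurable A -> measurable (ball1 `&` dir @^-1` A).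
Proof.
move=> mA; apply: measurableI => //; rewrite -[X in measurable X]setTI.
exact: measurable_direction.
Qed.

Let surface0 : surface_measure (set0 : set 'rV[R]_n) = 0.
Proof. by rewrite surfaceE /nu preimage_set0 setI0 measure0 mule0. Qed.

Let surface_ge0 (A : set 'rV[R]_n) : 0 <= surface_measure A.
Proof.
rewrite surfaceE; apply: mule_ge0; first by rewrite lee_fin.
exact: (measure_ge0 (@lebesgue_rV R n)).
Qed.

Let surface_sigma_additive : semi_sigma_additive (@surface_measure R n).
Proof.
move=> F mF tF mUF; rewrite surfaceE /nu preimage_bigcup setI_bigcupr.
under eq_fun do under eq_bigr do rewrite surfaceE.
have := @measure_semi_sigma_additive _ _ R
  (mscale (n%:R%:nng)%R (@lebesgue_rV R n)) (fun i => ball1 `&` dir @^-1` F i).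
apply.
- by move=> i; exact: mcone.
- apply/trivIsetP => /= i j _ _ ij.
  rewrite setIACA setIid -preimage_setI.
  by move/trivIsetP : tF => /(_ _ _ _ _ ij) ->//; rewrite preimage_set0 setI0.
- by rewrite -setI_bigcupr -preimage_bigcup; exact: mcone.
Qed.

HB.instance Definition _ := isMeasure.Build _ _ _ (@surface_measure R n)
  surface0 surface_ge0 surface_sigma_additive.

Lemma surface_measure_setC_sphere : surface_measure (~` @sphere R n) = 0.
Proof.
rewrite surfaceE /nu (_ : _ `&` _ = set0) ?measure0 ?mule0//.
apply/seteqP; split => // x [/andP[x0 _]] /=; apply; rewrite /sphere /= /dir.
rewrite /enorm (_ : dotr _ _ = (enorm x)^-1 ^+ 2 * dotr x x)%R.
  rewrite sqrtrM ?sqr_ge0// sqrtr_sqr ger0_norm ?invr_ge0 ?sqrtr_ge0//.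
  by rewrite mulVf// gt_eqF.
rewrite /dotr mulr_sumr; apply: eq_bigr => i _.
by rewrite !mxE expr2 mulrACA.
Qed.

End surface_measure.

(* L^infty of the sphere: [a] is a Borel representative. Its values off the
   sphere play no role, by [surface_measure_setC_sphere]. *)
Definition Linfty_sphere (R : realType) (n : nat) (a : 'rV[R]_n -> R) : Prop :=
  measurable_fun (@sphere R n) a /\
  ('N[@surface_measure R n]_+oo [EFin \o a] < +oo)%E.

Fixpoint Ck (R : realType) (n k : nat) (u : 'rV[R]_n -> R) : Prop :=
  continuous u /\
  match k with
  | 0 => True
  | k'.+1 => forall i : 'I_n, (forall x, derivable u x (delta_mx 0 i)) /\
                              Ck k' ('D_(delta_mx 0 i) u)
  end.

Definition L1_loc (R : realType) (n : nat) (u : 'rV[R]_n -> R) : Prop :=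
  forall K : set 'rV[R]_n, compact K ->
    (@lebesgue_rV R n).-integrable K (EFin \o u).

Definition at_infinity (R : realType) (n : nat) : set_system 'rV[R]_n :=
  [set A | \forall r \near +oo, [set x | r < enorm x] `<=` A].

Definition space_Ls (R : realType) (n : nat) (s : R) (u : 'rV[R]_n -> R)
    : Prop :=
  L1_loc u /\
  exists2 delta : R, 0 < delta <= 2 * s &
    (limf_esup (fun x => (`|u x| / enorm x `^ (2 * s - delta))%:E)
               (@at_infinity R n) < +oo)%E.

(* [Rintegral] is total (0 by convention when the integral is infinite); for
   [u] in [Ck 2] and [space_Ls s], [0 < s < 1] and [a] in [Linfty_sphere], the
   integral converges absolutely, so that the convention is never used. *)
Definition stable_op (R : realType) (n : nat) (s : R) (a u : 'rV[R]_n -> R)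
    (x : 'rV[R]_n) : R :=
  \int[@lebesgue_rV R n]_y
    ((u (x + y) + u (x - y) - 2 * u x) / enorm y `^ (n%:R + 2 * s)
     * a ((enorm y)^-1 *: y)).

(* Main.v *)
Require Import Defs.
From HB Require Import structures.
From mathcomp Require Import all_boot all_order all_algebra.
From mathcomp Require Import all_classical all_reals all_analysis.
From mathcomp Require Import measurable_realfun lra ring.

Set Implicit Arguments.
Unset Strict Implicit.
Unset Printing Implicit Defensive.

Import Order.TTheory GRing.Theory Num.Theory.
Import numFieldNormedType.Exports.

Local Open Scope classical_set_scope.
Local Open Scope ring_scope.

(* Rescaled test functions w_r(x) = (1 + |x|^2/r^2)^-(N+2) satisfy
   -L w_r <= K r^(-2s) w_r, for any kernel 0 <= a <= D: by the parallelogram law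
   and the convexity of t |-> 1/(1 + t), the second difference of
   (1 + |x|^2/r^2)^-1 is at least -2 (1 + |x|^2/r^2)^-1 min(1, |y|^2/r^2), and
   tangent lines transfer this to powers.  The same bound holds for
   max(0, (1 + |x|^2/r^2)^-1 - eps)^(N+2), which has compact support, so that L can
   be moved from u to it by Fubini's theorem and translation invariance: near
   y = 0 the C^2 bound on u gives absolute convergence, at infinity its growth does.
   Letting eps tend to 0, int u^p w_r <= K r^(-2s) int u w_r.

   If p = 1, take r large.  If p > 1, then u <= l + l^(1-p) u^p with
   l = L r^(-2s/(p-1)) turns this into J(r) := int u^p w_r <= K C L + K L^(1-p) J(r)
   for r >= 1, because p <= N/(N-2s) makes the power of r nonpositive; for L large,
   u^p is integrable.  Splitting u = u w_rho + u (1 - w_rho) before using the same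
   inequality and letting r, then rho, tend to infinity gives int u^p <= (K C + 2) L
   for every L > 0. *)

(** * Affine changes of variables *)

(** The cutoff by eps is forced by what is known of u: its second differences are bounded uniformly
    only for x in a bounded set, as second derivatives may grow at any rate, so Fubini's theorem is
    applied with a compactly supported weight. The power N+2 makes w_r decay like |x|^-(2N+4),
    enough to absorb the growth of u, which is slower than |x|^2 because s < 1. The exponent
    2s/(p-1) in l is the one for which l^(1-p) r^(-2s) no longer depends on r. At the critical p
    nothing decays in r, so one large radius yields a bound but no smallness; this is why the tail
    of int u^p has to be split off through w_rho. Integrals are estimated over sup-norm balls: these
    are cubes, with explicit volume for an iterated integral, and dyadic families of cubes do the
    work of polar coordinates. *)

Lemma lebesgue_measure_affine (R : realType) (c v : R)
    (A : set (measurableTypeR R)) : 0 < c -> measurable A ->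
  (c%:E * lebesgue_measure
     ((fun x : measurableTypeR R => (c * x + v : measurableTypeR R)%R) @^-1` A) =
   lebesgue_measure A)%E.
Proof.
move=> c0 mA; pose phi (x : measurableTypeR R) : measurableTypeR R := c * x + v.
have mphi : measurable_fun setT phi.
  by apply: measurable_funD => //; exact: measurable_funM.
have c0' : 0 <= c by exact: ltW.
(* Lebesgue measure is the only measure giving each []a, b]] its length; the image measure under
   [phi], scaled by [c], does so too. *)
pose mu : {measure set (measurableTypeR R) -> \bar R} := 
  mscale (NngNum c0') (pushforward (@lebesgue_measure R) phi).
suff -> : lebesgue_measure A = mu mphi A by [].
apply: lebesgue_measure_unique => // _ [[a b]] _ <-.
rewrite -[RHS]/(c%:E * lebesgue_measure (phi @^-1` `]a, b]))%E.
rewrite [X in (_ * lebesgue_measure X)%E](_ : _ = `](a - v) / c, (b - v) / c]%classic); last first.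
  apply/seteqP; split => x /=; rewrite !in_itv/= /phi ltr_pdivrMr// ler_pdivlMr//;
    rewrite ltrBlDr lerBrDr mulrC //.
rewrite !lebesgue_measure_itv /= !lte_fin ltr_pM2r ?invr_gt0// ltrD2r.
case: ifPn => ab; last by rewrite mule0.
by rewrite -!EFinB -EFinM -mulrBl mulrCA divff ?gt_eqF// mulr1; congr EFin; ring.
Qed.

Lemma measurable_affine_rV (R : realType) n (c : R) (v : 'rV[R]_n) :
  measurable_fun setT (fun x : 'rV[R]_n => c *: x + v).
Proof.
apply: measurable_rVP => i; under eq_fun do rewrite !mxE.
apply: measurable_funD => //; apply: measurable_funM => //.
exact: measurable_coord_rV.
Qed.

Lemma ge0_integral_affine1 (R : realType) (c v : R)
    (f : measurableTypeR R -> \bar R) : 0 < c ->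
  measurable_fun setT f -> (forall x, (0 <= f x)%E) ->
  (c%:E * \int[lebesgue_measure]_x f (c * x + v)%R =
   \int[lebesgue_measure]_x f x)%E.
Proof.
move=> c0 mf f0; have c0' : 0 <= c by exact: ltW.
pose phi (x : measurableTypeR R) : measurableTypeR R := c * x + v.
have mphi : measurable_fun setT phi.
  by apply: measurable_funD => //; exact: measurable_funM.
have := @ge0_integral_pushforward _ _ _ _ R phi mphi (@lebesgue_measure R)
  setT f measurableT mf (fun y _ => f0 y).
rewrite preimage_setT => <-.
pose mu : {measure set (measurableTypeR R) -> \bar R} :=
  pushforward (@lebesgue_measure R) phi.
transitivity (\int[mscale (NngNum c0') (mu mphi)]_x f x)%E.
  by rewrite ge0_integral_mscale.
apply: eq_measure_integral => A mA _; rewrite /= /mscale /=.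
exact: lebesgue_measure_affine.
Qed.

(** By induction on the dimension: the slice at [t] of the preimage is the preimage, under the map
    in the remaining coordinates, of the slice of [A] at [c * t + v 0 0]. The outer integral is then
    a one-dimensional change of variables, and each coordinate contributes one factor [c]. *)
Lemma lebesgue_rV_affine (R : realType) n (c : R) (v : 'rV[R]_n)
    (A : set 'rV[R]_n) : 0 < c -> measurable A ->
  ((c ^+ n)%:E * lebesgue_rV ((fun x : 'rV[R]_n => c *: x + v)%R @^-1` A) =
   lebesgue_rV A)%E.
Proof.
move=> c0; elim: n v A => [|n IH] v A mA.
  rewrite expr0 mul1e /=; congr (\d_ _ _)%E; apply/seteqP; split=> x /=;
  by rewrite [_ + v]thinmx0 [x]thinmx0.
have mpre (B : set 'rV[R]_n.+1) : measurable B -> measurable (@cons_rV R n @^-1` B).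
  by move=> mB; rewrite -[X in measurable X]setTI; exact: measurable_cons_rV.
pose h (t : measurableTypeR R) := lebesgue_rV (xsection (@cons_rV R n @^-1` A) t).
have mh : measurable_fun setT h by exact: measurable_fun_xsection (mpre _ mA).
have -> : lebesgue_rV A = (\int[lebesgue_measure]_t h t)%E.
  by rewrite lebesgue_rVS.
rewrite -(@ge0_integral_affine1 _ c (v 0 0)) //.
rewrite lebesgue_rVS /product_measure1 exprS EFinM -muleA; congr (_ * _)%E.
rewrite -ge0_integralZl//.
- apply: eq_integral => t _ /=.
  have mx := measurable_xsection (c * t + v 0 0) (mpre _ mA).
  rewrite /h -(IH (\row_i v 0 (lift ord0 i)) _ mx).
  congr (_ * lebesgue_rV _)%E.
  have E w : c *: @cons_rV R n (t, w) + v =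
      cons_rV (c * t + v 0 0, c *: w + \row_i v 0 (lift ord0 i)).
    apply/rowP => i; rewrite 2!mxE; have [j ->|->] := unliftP ord0 i.
      by rewrite !cons_rVS !mxE.
    by rewrite !cons_rV0.
  by apply/seteqP; split => w; rewrite /xsection/= !inE/= E.
- apply: measurable_fun_xsection; apply: mpre; rewrite -[X in measurable X]setTI.
  exact: measurable_affine_rV.
- by rewrite lee_fin exprn_ge0// ltW.
Qed.

(** * Euclidean length and sup norm *)

Section euclidean_norm.
Context {R : realType} {n : nat}.
Implicit Types x y : 'rV[R]_n.

Lemma dotr_ge0 x : 0 <= dotr x x.
Proof. by apply: sumr_ge0 => i _; rewrite -expr2 sqr_ge0. Qed.

Lemma sqr_enorm x : enorm x ^+ 2 = dotr x x.
Proof. by rewrite sqr_sqrtr// dotr_ge0. Qed.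

Lemma enorm_ge0 x : 0 <= enorm x.
Proof. exact: sqrtr_ge0. Qed.

Lemma enormZ c x : enorm (c *: x) = `|c| * enorm x.
Proof.
rewrite /enorm (_ : dotr _ _ = c ^+ 2 * dotr x x).
  by rewrite sqrtrM ?sqr_ge0// sqrtr_sqr.
by rewrite /dotr mulr_sumr; apply: eq_bigr => i _; rewrite !mxE; ring.
Qed.

Lemma norm_le_enorm x : `|x| <= enorm x.
Proof.
rewrite [leLHS]/Num.Def.normr/= mx_normrE; apply/bigmax_leP; split=> [|[i j] _ /=].
  exact: enorm_ge0.
rewrite ord1 -sqrtr_sqr ler_wsqrtr// /dotr (bigD1 j)//= expr2 lerDl.
by apply: sumr_ge0 => k _; rewrite -expr2 sqr_ge0.
Qed.

Lemma coord_le_norm x i : `|x 0 i| <= `|x|.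
Proof.
rewrite [leRHS]/Num.Def.normr/= mx_normrE.
exact: (le_bigmax _ (fun ij => `|x ij.1 ij.2|) (0, i)).
Qed.

Lemma dotr_le_norm x : dotr x x <= n%:R * `|x| ^+ 2.
Proof.
rewrite mulr_natl -[X in _ *+ X]card_ord -sumr_const.
apply: ler_sum => i _; rewrite -expr2 -real_normK ?num_real//.
by rewrite lerXn2r ?nnegrE// coord_le_norm.
Qed.

Lemma enorm_eq0 x : (enorm x == 0) = (x == 0).
Proof.
apply/idP/idP => [/eqP x0|/eqP ->].
  by rewrite -normr_le0 -x0 norm_le_enorm.
by rewrite -[X in enorm X](scale0r 0) enormZ normr0 mul0r.
Qed.

Lemma enorm_gt0 x : (0 < enorm x) = (x != 0).
Proof. by rewrite lt_neqAle enorm_ge0 andbT eq_sym enorm_eq0. Qed.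

Lemma parallelogram x y :
  dotr (x + y) (x + y) + dotr (x - y) (x - y) = 2 * (dotr x x + dotr y y).
Proof.
rewrite /dotr -!big_split/= mulr_sumr; apply: eq_bigr => i _.
by rewrite !mxE; ring.
Qed.

End euclidean_norm.

Lemma ge0_integral_shift (R : realType) n (v : 'rV[R]_n)
    (f : 'rV[R]_n -> \bar R) :
  measurable_fun setT f -> (forall x, (0 <= f x)%E) ->
  (\int[@lebesgue_rV R n]_x f (x + v)%R = \int[@lebesgue_rV R n]_x f x)%E.
Proof.
move=> mf f0; pose phi (x : 'rV[R]_n) := 1 *: x + v.
have mphi : measurable_fun setT phi by exact: measurable_affine_rV.
pose mu : {measure set 'rV[R]_n -> \bar R} := pushforward (@lebesgue_rV R n) phi.
have := @ge0_integral_pushforward _ _ _ _ R phi mphi (@lebesgue_rV R n)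
  setT f measurableT mf (fun y _ => f0 y).
rewrite preimage_setT => fE.
transitivity (\int[@lebesgue_rV R n]_x f (1 *: x + v)%R)%E.
  by apply: eq_integral => x _; rewrite scale1r.
rewrite -[LHS]fE -[LHS]/(\int[mu mphi]_x f x)%E.
apply: eq_measure_integral => A mA _.
rewrite -[RHS](@lebesgue_rV_affine R n 1 v)// ?expr1n ?mul1e//.
Qed.

(** The cone over the exceptional set inside the unit ball is null, since [n] times its volume is
    the surface measure. The cones of radius [k.+1] are dilates of it, hence null as well, and
    together they contain every nonzero vector with an exceptional direction. *)
Lemma ae_direction (R : realType) n (P : set 'rV[R]_n) : (0 < n)%N ->
  (\forall t \ae @surface_measure R n, sphere t -> P t) ->
  \forall x \ae @lebesgue_rV R n, x != 0 -> P ((enorm x)^-1 *: x).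
Proof.
move=> n0 [B [mB B0 sB]].
pose Z k := [set x : 'rV[R]_n | (0 < enorm x <= k.+1%:R)%R /\
                                  B ((enorm x)^-1 *: x)%R].
have Z0 : lebesgue_rV (Z 0) = 0%E.
  move: B0; rewrite /surface_measure => /eqP; rewrite mule_eq0 => /orP[|/eqP//].
  by rewrite eqe pnatr_eq0 -leqn0 leqNgt n0.
have mZ : measurable (Z 0).
  rewrite (_ : Z 0 = [set x | (0 < enorm x <= 1)%R] `&`
    (fun x : 'rV[R]_n => (enorm x)^-1 *: x) @^-1` B)//.
  apply: measurableI.
    rewrite (_ : [set _ | _] = @enorm R n @^-1` `]0%R, 1%R]); last first.
      by apply/seteqP; split => x /=; rewrite in_itv.
    by rewrite -[X in measurable X]setTI; exact: measurable_enorm.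
  rewrite -[X in measurable X]setTI; exact: measurable_direction.
have kK k : Z k = (fun x => k.+1%:R^-1 *: x + 0) @^-1` Z 0.
  apply/seteqP; split => x /=; rewrite /Z /= addr0 enormZ ger0_norm// invfM;
  rewrite ler_pdivrMl// mulr1 pmulr_rgt0// scalerA invrK mulrAC mulfV ?mul1r//.
have ZZ k : (@lebesgue_rV R n).-negligible (Z k).
  exists (Z k); split => //.
    by rewrite kK -[X in measurable X]setTI; exact: measurable_affine_rV.
  have k0 : 0 < k.+1%:R^-1 :> R by [].
  have := lebesgue_rV_affine 0 k0 mZ; rewrite -kK Z0 => /eqP.
  rewrite mule_eq0 => /orP[|/eqP//]; rewrite eqe expf_eq0 => /andP[_].
  by rewrite gt_eqF.
have := negligible_bigcup ZZ; apply: negligibleS => x /= /not_implyP[x0 Px].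
have [k xk] : exists k, enorm x <= k.+1%:R.
  exists (Num.bound (enorm x)); apply: ltW; rewrite (lt_trans (archi_boundP (enorm_ge0 x)))//.
  by rewrite ltr_nat.
exists k => //; split; first by rewrite xk enorm_gt0 x0.
apply: sB => /=; apply/not_implyP; split => //.
by rewrite /sphere/= enormZ ger0_norm ?invr_ge0 ?enorm_ge0// mulVf// enorm_eq0.
Qed.

(** * Integrals of powers of the norm *)

Lemma lebesgue_rV_cube (R : realType) n (r : R) : (0 < n)%N -> 0 <= r ->
  @lebesgue_rV R n [set x | `|x| <= r] = ((2 * r) ^+ n)%:E.
Proof.
move=> n0 r0; rewrite (_ : [set x | _] =
    [set v : 'rV[R]_n | forall i, `[- r, r]%classic (v 0 i)]).
  rewrite (@lebesgue_rV_box _ _ (fun=> `[- r, r]%classic)); last first.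
    by move=> _; exact: measurable_itv.
  under eq_bigr do rewrite lebesgue_measure_itv/= lte_fin.
  case: ifPn => rr; last first.
    have -> : r = 0 by apply/eqP; rewrite eq_le r0 andbT; lra.
    by rewrite prodEFin prodr_const card_ord mulr0.
  under eq_bigr do rewrite -EFinB.
  by rewrite prodEFin prodr_const card_ord; congr (_ ^+ _)%:E; ring.
apply/seteqP; split => x /= xr.
  by move=> i; rewrite in_itv/= -ler_norml (le_trans (coord_le_norm x i)).
rewrite [leLHS]/Num.Def.normr/= mx_normrE; apply/bigmax_leP; split=> // -[i j] _ /=.
by rewrite ord1 ler_norml; have := xr j; rewrite in_itv.
Qed.

Lemma measurable_norm_rV (R : realType) n :
  measurable_fun setT (fun x : 'rV[R]_n => `|x|).
Proof.
apply: (measurability _ (RGenOpens.measurableE R)) => //.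
move=> _ [_ [a [b ->] <-]]; rewrite setTI; apply: open_measurable_rV.
have /continuousP := @norm_continuous R 'rV[R]_n; apply.
exact: interval_open.
Qed.

Lemma measurable_cube (R : realType) n (r : R) :
  measurable [set x : 'rV[R]_n | `|x| <= r].
Proof.
rewrite (_ : [set x | _] = (fun x : 'rV[R]_n => `|x|) @^-1` `]-oo, r]).
  by rewrite -[X in measurable X]setTI; exact: measurable_norm_rV.
by apply/seteqP; split=> x /=; rewrite in_itv.
Qed.

Lemma measurable_cubeC (R : realType) n (r : R) :
  measurable [set x : 'rV[R]_n | r < `|x| ].
Proof.
rewrite (_ : [set x | _] = (fun x : 'rV[R]_n => `|x|) @^-1` `]r, +oo[).
  by rewrite -[X in measurable X]setTI; exact: measurable_norm_rV.
by apply/seteqP; split=> x /=; rewrite in_itv/= andbT.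
Qed.

Lemma geometric_sum_le (R : realType) (q : R) m : 0 <= q < 1 ->
  \sum_(j < m) q ^+ j <= (1 - q)^-1.
Proof.
move=> /andP[q0 q1]; have q1' : 0 < 1 - q by rewrite subr_gt0.
rewrite -[leRHS]mul1r ler_pdivlMr// mulrC.
by have := subrX1 q m; rewrite -opprB -(opprB 1 q) mulNr => /oppr_inj <-;
  rewrite lerBlDr lerDl exprn_ge0.
Qed.

(** Pointwise [f] is at most the sum over [j] of [c j] times the indicator of the cube of half-side
    [rho j]; integrating termwise leaves a geometric series. The cubes may overlap, so no partition
    into shells is needed. *)
Lemma integral_le_geometric (R : realType) n (D : set 'rV[R]_n)
    (f : 'rV[R]_n -> R) (c rho : nat -> R) (K q : R) : (0 < n)%N ->
  measurable D -> measurable_fun D f -> (forall x, D x -> 0 <= f x) ->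
  (forall j, 0 <= c j) -> (forall j, 0 <= rho j) -> 0 <= K -> 0 <= q < 1 ->
  (forall x, D x -> exists j, `|x| <= rho j /\ f x <= c j) ->
  (forall j, c j * (2 * rho j) ^+ n <= K * q ^+ j) ->
  (\int[@lebesgue_rV R n]_(x in D) (f x)%:E <= (K / (1 - q))%:E)%E.
Proof.
move=> n0 mD mf f0 c0 r0 K0 q01 Df crK.
pose B j := [set x : 'rV[R]_n | `|x| <= rho j].
have mB j : measurable (B j) by exact: measurable_cube.
pose g j x := ((c j)%:E * (\1_(B j) x)%:E)%E.
have g0 j x : (0 <= g j x)%E by rewrite mule_ge0// lee_fin.
have mg j : measurable_fun setT (g j).
  by apply: measurable_funeM; apply/measurable_EFinP; exact: measurable_indic.
have mgD j : measurable_fun D (g j) by exact: measurable_funTS.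
apply: (@le_trans _ _ (\int[@lebesgue_rV R n]_(x in D) \sum_(j <oo) g j x))%E.
  apply: ge0_le_integral => //.
  - exact/measurable_EFinP.
  - have := @ge0_emeasurable_sum _ _ _ D g xpredT (fun k x _ _ => g0 k x).
    by apply=> k _; exact: mgD.
  - move=> x Dx; have [j [xj fj]] := Df x Dx.
    apply: (@le_trans _ _ (g j x)); first by rewrite /g indicE mem_set// mule1 lee_fin.
    apply: le_trans (nneseries_lim_ge j.+1 _) => //.
    by rewrite big_nat_recr//= leeDr// sume_ge0.
rewrite integral_nneseries//.
apply: lime_le.
  by apply: is_cvg_nneseries => j _ _; exact: integral_ge0.
apply: nearW => m.
apply: (@le_trans _ _ (\sum_(0 <= j < m) (K * q ^+ j)%:E)%E).
  apply: lee_sum => j _.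
  apply: (@le_trans _ _ (\int[@lebesgue_rV R n]_x g j x)%E).
    exact: ge0_subset_integral.
  rewrite /g ge0_integralZl//; last by rewrite lee_fin.
    rewrite integral_indic// setIT.
    by rewrite [X in (_ * X)%E](lebesgue_rV_cube n0 (r0 j)) -EFinM lee_fin.
  by apply/measurable_EFinP; exact: measurable_indic.
rewrite sumEFin lee_fin -mulr_sumr big_mkord ler_wpM2l//.
exact: geometric_sum_le.
Qed.

Lemma powR_exprn (R : realType) (t b : R) j : 0 <= t ->
  (t ^+ j) `^ b = (t `^ b) ^+ j.
Proof.
by move=> t0; rewrite -powR_mulrn// -powRrM mulrC powRrM powR_mulrn// powR_ge0.
Qed.

Lemma exists_half_shell (R : realType) (r t : R) : 0 < t <= r ->
  exists j, r * 2^-1 ^+ j.+1 < t <= r * 2^-1 ^+ j.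
Proof.
move=> /andP[t0 tr]; have r0 : 0 < r by rewrite (lt_le_trans t0).
have ex : exists j, r * 2^-1 ^+ j.+1 < t.
  have /cvgrPdist_lt/(_ (t / r)) : (fun j => 2^-1 ^+ j : R) @ \oo --> 0.
    by apply: cvg_expr; rewrite ger0_norm// invf_lt1// ltr1n.
  rewrite divr_gt0// => /(_ isT)[m _ /(_ m (leqnn m))].
  rewrite /= sub0r normrN ger0_norm ?exprn_ge0// ltr_pdivlMr// mulrC => h.
  exists m; apply: le_lt_trans h; rewrite ler_pM2l// exprS.
  by rewrite ler_piMl// ?exprn_ge0// invf_le1 ?ler1n.
case: (ex_minnP ex) => j jt jmin; exists j; rewrite jt/=.
case: j {jt} jmin => [|j jmin]; first by rewrite expr0 mulr1.
by rewrite leNgt; apply/negP => /jmin; rewrite ltnn.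
Qed.

Lemma exists_double_shell (R : realType) (r t : R) : 0 < r < t ->
  exists j, r * 2 ^+ j < t <= r * 2 ^+ j.+1.
Proof.
move=> /andP[r0 rt].
have ex : exists j, t <= r * 2 ^+ j.+1.
  exists (Num.bound (t / r)); rewrite mulrC -ler_pdivrMr//.
  have tr0 : 0 <= t / r by rewrite divr_ge0// ?ltW// (lt_trans r0).
  rewrite (le_trans (ltW (archi_boundP tr0)))// -natrX ler_nat.
  exact/ltnW/(ltn_trans (ltnSn _))/ltn_expl.
case: (ex_minnP ex) => j jt jmin; exists j; rewrite jt andbT.
case: j {jt} jmin => [|j jmin]; first by rewrite expr0 mulr1.
by rewrite ltNge; apply/negP => /jmin; rewrite ltnn.
Qed.

Lemma measurable_norm_powR (R : realType) n (D : set 'rV[R]_n) (b : R) :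
  measurable_fun D (fun x => `|x| `^ b).
Proof.
apply: measurable_funTS; apply: (measurableT_comp (measurable_powR b)).
exact: measurable_norm_rV.
Qed.

Lemma powR_lt1 (R : realType) (t b : R) : 0 <= t < 1 -> 0 < b -> t `^ b < 1.
Proof.
move=> /andP[t0 t1] b0.
have := @gt0_ltr_powR R b b0 t 1; rewrite !nnegrE powR1; exact.
Qed.

Lemma powRN_le (R : realType) (x y b : R) : 0 < x -> x <= y -> 0 <= b ->
  y `^ (- b) <= x `^ (- b).
Proof.
move=> x0 xy b0; have y0 := lt_le_trans x0 xy.
rewrite !powRN lef_pV2 ?posrE ?powR_gt0//.
by apply: ge0_ler_powR => //; rewrite nnegrE ltW.
Qed.

(** On the shell between [r * h ^+ j.+1] and [r * h ^+ j] the integrand is largest at the inner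
    edge, and the enclosing cube has volume (2 r h^j)^n. The ratio of the resulting series is
    h^(n-b), below 1 because [b < n]. *)
Lemma integral_norm_powR_near (R : realType) n (b : R) : (0 < n)%N ->
  0 <= b < n%:R ->
  exists2 C, 0 <= C & forall r, 0 < r ->
    (\int[@lebesgue_rV R n]_(x in [set x | (`|x| <= r)%R]) (`|x| `^ (- b))%:E
       <= (C * r `^ (n%:R - b))%:E)%E.
Proof.
move=> n0 /andP[b0 bn]; pose h : R := 2^-1.
have h0 : 0 < h by rewrite invr_gt0.
have h1 : h < 1 by rewrite invf_lt1// ltr1n.
pose X := h `^ (- b); pose q := h `^ (n%:R - b).
have X0 : 0 <= X by exact: powR_ge0.
have q01 : 0 <= q < 1 by rewrite powR_ge0 powR_lt1 ?ltW ?subr_gt0.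
exists (2 ^+ n * X / (1 - q)).
  by rewrite !mulr_ge0 ?exprn_ge0 ?invr_ge0// subr_ge0 ltW//; case/andP: q01.
move=> r r0.
rewrite [X in (_ <= X%:E)%E](_ : _ = 2 ^+ n * X * r `^ (n%:R - b) / (1 - q)); last by ring.
apply: (@integral_le_geometric _ _ _ _ (fun j => (r * h ^+ j.+1) `^ (- b))
  (fun j => r * h ^+ j)) => //.
- exact: measurable_cube.
- exact: measurable_norm_powR.
- by move=> j; exact: powR_ge0.
- by move=> j; rewrite mulr_ge0 ?exprn_ge0 ?ltW.
- by rewrite !mulr_ge0 ?exprn_ge0 ?powR_ge0.
(* The origin lies in no shell. There the power is 0 for nonzero [b] and 1 for [b = 0], so the bound
   with index 0 serves. *)
- move=> x /= xr; have [->|x0] := eqVneq x 0.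
    exists 0; rewrite normr0 expr0 mulr1 ltW//; split => //.
    have [->|bn0] := eqVneq b 0; first by rewrite oppr0 !powRr0.
    by rewrite powR0 ?oppr_eq0 ?powR_ge0.
  have [|j /andP[j1 j2]] := @exists_half_shell _ r `|x|; first by rewrite normr_gt0 x0.
  by exists j; split => //; apply: powRN_le => //; [rewrite mulr_gt0 ?exprn_gt0|exact: ltW].
- have [h0' r0'] := (ltW h0, ltW r0).
  move=> j; rewrite powRM ?exprn_ge0// powR_exprn// -/X.
  have -> : q = h ^+ n * X.
    by rewrite /q powRD ?powR_mulrn ?ltW// (gt_eqF h0) implybT.
  rewrite powRD; last by rewrite (gt_eqF r0) implybT.
  rewrite powR_mulrn// !exprMn -!exprM [(j * n)%N]mulnC exprS.
  rewrite le_eqVlt; apply/orP; left; apply/eqP; ring.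
Qed.

(** The same sum over the shells between [r * 2 ^+ j] and [r * 2 ^+ j.+1], with ratio 2^(n-b). The
    enclosing cube has side [4 * r * 2 ^+ j], whence the factor [4 ^+ n]. *)
Lemma integral_norm_powR_far (R : realType) n (b : R) : (0 < n)%N ->
  n%:R < b ->
  exists2 C, 0 <= C & forall r, 0 < r ->
    (\int[@lebesgue_rV R n]_(x in [set x | (r < `|x|)%R]) (`|x| `^ (- b))%:E
       <= (C * r `^ (n%:R - b))%:E)%E.
Proof.
move=> n0 bn; have b0 : 0 <= b by rewrite (le_trans _ (ltW bn)).
pose X : R := 2 `^ (- b); pose q : R := 2^-1 `^ (b - n%:R).
have qE : q = 2 ^+ n * X.
  rewrite /q -[2^-1](@powR_inv1 R 2)// -powRrM mulN1r opprB powRD ?pnatr_eq0 ?implybT//.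
  by rewrite powR_mulrn.
have q01 : 0 <= q < 1.
  rewrite powR_ge0/=; apply: powR_lt1; last by rewrite subr_gt0.
  by rewrite invr_ge0 ler0n/= invf_lt1 ?ltr1n ?ltr0n.
exists (4 ^+ n / (1 - q)).
  by rewrite !mulr_ge0 ?exprn_ge0 ?invr_ge0// subr_ge0 ltW//; case/andP: q01.
move=> r r0; rewrite [X in (_ <= X%:E)%E](_ : _ = 4 ^+ n * r `^ (n%:R - b) / (1 - q)); last first.
  by ring.
apply: (@integral_le_geometric _ _ _ _ (fun j => (r * 2 ^+ j) `^ (- b))
  (fun j => r * 2 ^+ j.+1)) => //.
- exact: measurable_cubeC.
- exact: measurable_norm_powR.
- by move=> j; exact: powR_ge0.
- by move=> j; rewrite mulr_ge0 ?exprn_ge0 ?ltW.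
- by rewrite !mulr_ge0 ?exprn_ge0 ?powR_ge0.
- move=> x /= xr; have [|j /andP[j1 j2]] := @exists_double_shell _ r `|x|; first by rewrite r0.
  by exists j; split => //; apply: powRN_le => //; [rewrite mulr_gt0 ?exprn_gt0|exact: ltW].
- have r0' := ltW r0.
  move=> j; rewrite powRM ?exprn_ge0// powR_exprn// -/X qE.
  rewrite powRD; last by rewrite (gt_eqF r0) implybT.
  rewrite powR_mulrn// !exprMn -!exprM mulSn exprD [(n * j)%N]mulnC.
  rewrite (_ : 4 = 2 * 2 :> R) ?exprMn; last by ring.
  by rewrite le_eqVlt; apply/orP; left; apply/eqP; rewrite -/X; ring.
Qed.

(** * Second differences of C^2 functions *)

Section partial_derivatives.
Context {R : realType} {n : nat}.
Implicit Types (f : 'rV[R]_n -> R) (x y p q : 'rV[R]_n).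

Lemma is_derive_line f x v t : derivable f (x + t *: v) v ->
  is_derive t 1 (fun t : R => f (x + t *: v)) ('D_v f (x + t *: v)).
Proof.
move=> df; have E : (fun h : R => h^-1 *: (((fun t : R => f (x + t *: v)) \o shift t) (h *: 1) -
      f (x + t *: v))) =
    (fun h : R => h^-1 *: ((f \o shift (x + t *: v)) (h *: v) - f (x + t *: v))).
  apply/funext => h /=; congr (_ *: (f _ - _)).
  by rewrite [h *: 1]mulr1 scalerDl addrCA.
by split; [rewrite /derivable E|rewrite /derive E].
Qed.

(** The two conditions on [s] say that it lies between 0 and [t]; the mean value theorem is applied
    on [[0, t]] or on [[t, 0]]. *)
Lemma partial_lipschitz1 f (i : 'I_n) x (M : R) (t : R) :
  (forall y, derivable f y (delta_mx 0 i)) ->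
  (forall s, `|s| <= `|t| -> 0 <= s * t -> `|'D_(delta_mx 0 i) f (x + s *: delta_mx 0 i)| <= M) ->
  `|f (x + t *: delta_mx 0 i) - f x| <= M * `|t|.
Proof.
move=> df dM; set e := delta_mx 0 i in df dM *.
pose g (t : R) := f (x + t *: e).
have dg (s : R) : is_derive s (1 : R) g ('D_e f (x + s *: e)) by exact: is_derive_line.
have cg a b : {within `[a, b], continuous g}.
  apply: derivable_within_continuous => s _; exact: (@ex_derive _ _ _ _ _ _ _ (dg s)).
have g0 : f x = g 0 by rewrite /g scale0r addr0.
have [t0|t0] := leP 0 t.
  have [c] := MVT_segment t0 (fun s _ => dg s) (cg 0 t).
  rewrite in_itv/= => /andP[c0 ct]; rewrite g0 -/(g t) => ->.
  rewrite subr0 normrM ler_wpM2r// dM// ?mulr_ge0//.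
  by rewrite !ger0_norm// (le_trans c0).
have [c] := MVT_segment (ltW t0) (fun s _ => dg s) (cg t 0).
rewrite in_itv/= => /andP[ct c0]; rewrite g0 -/(g t) distrC => ->.
rewrite sub0r normrM normrN ler_wpM2r// dM//.
  by rewrite !ler0_norm// ?lerN2// ltW.
by rewrite mulr_le0// ltW.
Qed.

(** Only partial derivatives are at hand, so [q] is changed into [p] one coordinate at a time. Every
    intermediate point has coordinates between those of [p] and [q], so it stays in the same
    sup-norm ball. *)
Lemma partial_lipschitz f (M B : R) p q :
  (forall i x, derivable f x (delta_mx 0 i)) ->
  (forall i x, `|x| <= B -> `|'D_(delta_mx 0 i) f x| <= M) ->
  `|p| <= B -> `|q| <= B -> `|f p - f q| <= n%:R * M * `|p - q|.
Proof.
move=> df dM pB qB.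
have [n0|n0] := posnP n.
  have -> : p = q by apply/rowP => i; move: (ltn_ord i); rewrite {2}n0.
  by rewrite !subrr !normr0 mulr0.
have M0 : 0 <= M := le_trans (normr_ge0 _) (dM (Ordinal n0) p pB).
pose z (j : nat) : 'rV[R]_n := \row_i if (i < j)%N then p 0 i else q 0 i.
have zB (w : 'rV[R]_n) : (forall i, `|w 0 i| <= B) -> `|w| <= B.
  move=> wB; rewrite [leLHS]/Num.Def.normr/= mx_normrE; apply/bigmax_leP.
  by split=> [|[a b] _ /=]; [exact: le_trans pB|rewrite ord1].
have zn : z n = p by apply/rowP => i; rewrite mxE ltn_ord.
have z0 : z 0 = q by apply/rowP => i; rewrite mxE.
rewrite -zn -{1}z0 -(telescope_sumr (f \o z))// big_mkord.
apply: le_trans (ler_norm_sum _ _ _) _.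
rewrite -mulrA mulr_natl -[X in _ *+ X]card_ord -sumr_const.
apply: ler_sum => i _ /=; set t := p 0 i - q 0 i.
have zS : z i.+1 = z i + t *: delta_mx 0 i.
  apply/rowP => k; rewrite !mxE eqxx/= ltnS.
  have [->|ki] := eqVneq k i; first by rewrite leqnn ltnn mulr1 /t addrC subrK.
  by rewrite mulr0 addr0 leq_eqVlt (inj_eq val_inj) (negPf ki).
rewrite zS; apply: (@le_trans _ _ (M * `|t|)); last first.
  by rewrite ler_wpM2l// (le_trans _ (coord_le_norm _ i))// zn !mxE.
apply: partial_lipschitz1 => // s st s0; apply: dM; apply: zB => k.
rewrite !mxE eqxx/=; have [->|ki] := eqVneq k i; last first.
  rewrite mulr0 addr0; case: ifPn => _.
    exact: le_trans (coord_le_norm p k) pB.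
  exact: le_trans (coord_le_norm q k) qB.
rewrite ltnn mulr1.
have := le_trans (coord_le_norm p i) pB; have := le_trans (coord_le_norm q i) qB.
rewrite !ler_norml => /andP[q1 q2] /andP[p1 p2].
have [t0|t0] := leP 0 t.
  have s0' : 0 <= s.
    have [//|s0'] := leP 0 s; move: st.
    by rewrite (ler0_norm (ltW s0')) ger0_norm//; move: s0; rewrite /t in t0 *; nra.
  move: st; rewrite !ger0_norm// /t => st; apply/andP; split; lra.
have s0' : s <= 0.
  rewrite leNgt; apply/negP => s0'.
  by have := nmulr_rlt0 s t0; rewrite s0' ltNge mulrC s0.
move: st; rewrite (ler0_norm s0') (ltr0_norm t0) /t => st; apply/andP; split; lra.
Qed.

End partial_derivatives.

Section second_difference.
Context {R : realType} {n : nat}.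
Implicit Types (f u : 'rV[R]_n -> R) (x y : 'rV[R]_n).

Lemma compact_cube (B : R) : compact [set x : 'rV[R]_n | `|x| <= B].
Proof.
apply: bounded_closed_compact.
  exists B; split; first exact: num_real.
  by move=> M BM x /= xB; rewrite (le_trans xB)// ltW.
rewrite (_ : [set x | _] = (fun x : 'rV[R]_n => `|x|) @^-1` `]-oo, B]); last first.
  by apply/seteqP; split=> x /=; rewrite in_itv.
apply: closed_comp; last exact: interval_closed.
by move=> x _; exact: norm_continuous.
Qed.

Lemma continuous_bounded_cube f (B : R) : continuous f ->
  exists2 M, 0 <= M & forall x, `|x| <= B -> `|f x| <= M.
Proof.
move=> cf; have cK : compact (f @` [set x | `|x| <= B]).
  apply: continuous_compact; last exact: compact_cube.
  exact: continuous_subspaceT.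
have [M [_ MB]] := compact_bounded cK.
exists (Num.max (M + 1) 0); first by rewrite le_max lexx orbT.
move=> x xB; rewrite (le_trans (MB (M + 1) _ (f x) _))//.
- by rewrite ltrDl.
- by rewrite le_max lexx.
Qed.

Lemma is_derive_shift f x y v : derivable f (x + y) v ->
  is_derive x v (fun x => f (x + y)) ('D_v f (x + y)).
Proof.
move=> df; have E : (fun h : R => h^-1 *: (((fun x => f (x + y)) \o shift x) (h *: v) -
      f (x + y))) =
    (fun h : R => h^-1 *: ((f \o shift (x + y)) (h *: v) - f (x + y))).
  by apply/funext => h /=; rewrite addrA.
by split; [rewrite /derivable E|rewrite /derive E].
Qed.

(** The second difference is the increment over [y] of [H z = u (z + y) - u z]. The Lipschitz bound
    for the first partial derivatives of [u] bounds those of [H] by [n%:R * M2 * |y|], and the same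
    bound for [H] gives the second factor |y|. The radius [B + 2] leaves room for two shifts of norm
    at most 1. *)
Lemma second_difference_le u (B : R) : Ck 2 u ->
  exists2 M, 0 <= M & forall x y, `|x| <= B -> `|y| <= 1 ->
    `|u (x + y) + u (x - y) - 2 * u x| <= M * `|y| ^+ 2.
Proof.
move=> [_ Ck1]; pose e (i : 'I_n) : 'rV[R]_n := delta_mx 0 i.
have du i x : derivable u x (e i) by have [] := Ck1 i.
have ddu i j x : derivable ('D_(e i) u) x (e j).
  by have [_ [_ /(_ j)[]]] := Ck1 i.
have cddu i j : continuous ('D_(e j) ('D_(e i) u)).
  by have [_ [_ /(_ j)[_ []]]] := Ck1 i.
have bnd (ij : 'I_n * 'I_n) : {M : R | 0 <= M /\
    forall x, `|x| <= B + 2 -> `|'D_(e ij.2) ('D_(e ij.1) u) x| <= M}.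
  apply: cid; have [M M0 MB] := continuous_bounded_cube (B + 2) (cddu ij.1 ij.2).
  by exists M.
pose M2 := \sum_ij projT1 (bnd ij).
have M20 : 0 <= M2 by apply: sumr_ge0 => ij _; have [] := projT2 (bnd ij).
have M2P i j x : `|x| <= B + 2 -> `|'D_(e j) ('D_(e i) u) x| <= M2.
  move=> xB; rewrite /M2 (bigD1 (i, j))//=; have [_ /(_ x xB)/=] := projT2 (bnd (i, j)).
  move/le_trans; apply; rewrite lerDl; apply: sumr_ge0 => ij _.
  by have [] := projT2 (bnd ij).
exists (n%:R * (n%:R * M2)); first by rewrite !mulr_ge0.
move=> x y xB y1; pose H z := u (z + y) - u z.
have -> : u (x + y) + u (x - y) - 2 * u x = H x - H (x - y).
  by rewrite /H subrK; ring.
have dH i z : is_derive z (e i) H ('D_(e i) u (z + y) - 'D_(e i) u z).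
  apply: is_deriveB; first exact: is_derive_shift.
  exact/derivableP.
have := @partial_lipschitz _ _ H (n%:R * M2 * `|y|) (B + 1) x (x - y).
have -> : x - (x - y) = y by rewrite opprB addrC subrK.
move=> h.
rewrite (_ : _ * `|y| ^+ 2 = n%:R * (n%:R * M2 * `|y|) * `|y|); last by ring.
apply: h.
- by move=> i z; exact: (@ex_derive _ _ _ _ _ _ _ (dH i z)).
- move=> i z zB; rewrite (@derive_val _ _ _ _ _ _ _ (dH i z)).
  have := @partial_lipschitz _ _ ('D_(e i) u) M2 (B + 2) (z + y) z.
  have -> : z + y - z = y by rewrite addrC addKr.
  apply => //.
  + by move=> j w; exact: M2P.
  + by rewrite (le_trans (ler_normD _ _))//; lra.
  + by rewrite (le_trans zB)//; lra.
- by rewrite (le_trans xB)// lerDl.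
- by rewrite (le_trans (ler_normB _ _))// lerD.
Qed.

End second_difference.

Lemma enorm_le_norm (R : realType) n (x : 'rV[R]_n) : enorm x <= n%:R * `|x|.
Proof.
have x0 : 0 <= n%:R * `|x| by rewrite mulr_ge0.
rewrite -(ler_pXn2r (n := 2)) ?nnegrE ?enorm_ge0// sqr_enorm.
rewrite (le_trans (dotr_le_norm x))// exprMn ler_wpM2r ?sqr_ge0//.
by rewrite -natrX ler_nat expnS expn1; case: (n) => // m; rewrite leq_pmulr.
Qed.

(** A finite upper limit bounds the quotient outside a large ball, and continuity bounds [u] inside.
    The exponent is 2s - delta: the strict inequality [sigma < 2 * s] is the margin that makes
    |y|^sigma integrable against the kernel at infinity. *)
Lemma space_Ls_growth (R : realType) n (s : R) (u : 'rV[R]_n -> R) :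
  continuous u -> space_Ls s u ->
  exists sigma C, [/\ 0 <= sigma < 2 * s, 0 <= C &
    forall x, `|u x| <= C * (1 + `|x|) `^ sigma].
Proof.
move=> cu [_ [delta /andP[d0 d2s]]]; rewrite limf_esupE => /ereal_inf_lt[_ [V FV <-]].
set S := ereal_sup _ => Soo; pose sigma := 2 * s - delta.
have s0 : 0 <= sigma by rewrite subr_ge0.
(* The supremum is -oo when [V] is empty; 0 then serves. *)
have [A A0 SA] : exists2 A : R, 0 <= A & (S <= A%:E)%E.
  case: S Soo => [r _|//|_]; last by exists 0 => //; rewrite leNye.
  by exists (Num.max r 0); rewrite ?lee_fin le_max lexx ?orbT.
have [r0 [_ VP]] := FV.
(* The filter condition holds strictly beyond [r0], hence the increment; [0 <= r] makes the
   denominator positive for [enorm x > r]. *)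
pose r := Num.max (r0 + 1) 0.
have VA x : r < enorm x -> `|u x| <= A * enorm x `^ sigma.
  move=> rx; have Vx : V x by apply: (VP r) rx; rewrite /r lt_max ltrDl ltr01.
  have : ((`|u x| / enorm x `^ (2 * s - delta))%:E <= S)%E.
    by apply: ereal_sup_ubound; exists x.
  move=> /le_trans/(_ SA); rewrite lee_fin ler_pdivrMr// powR_gt0//.
  by rewrite (le_lt_trans _ rx)// le_max lexx orbT.
have [M M0 MP] := continuous_bounded_cube r cu.
exists sigma, (M + A * n%:R `^ sigma); split.
- by rewrite s0 /sigma ltrBlDr ltrDl.
- by rewrite addr_ge0// mulr_ge0// powR_ge0.
- move=> x; have x1 : 1 <= (1 + `|x|) `^ sigma.
    have h : 1 <= 1 + `|x| by rewrite lerDl.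
    by have := ler_powR h s0; rewrite powRr0.
  have [xr|xr] := leP (enorm x) r.
    have := MP x (le_trans (norm_le_enorm x) xr) => /le_trans; apply.
    rewrite mulrDl (@le_trans _ _ (M * (1 + `|x|) `^ sigma))//.
      by rewrite ler_peMr.
    by rewrite lerDl !mulr_ge0// powR_ge0.
  rewrite (le_trans (VA x xr))// mulrDl -mulrA -powRM//.
  rewrite (@le_trans _ _ (A * (n%:R * (1 + `|x|)) `^ sigma))//.
    rewrite ler_wpM2l//; apply: ge0_ler_powR => //; rewrite ?nnegrE ?enorm_ge0//.
    by rewrite (le_trans (enorm_le_norm x))// ler_wpM2l// lerDr.
  by rewrite lerDr mulr_ge0// powR_ge0.
Qed.

(** * Test functions *)

Section test_function.
Context {R : realType} {n : nat}.
Implicit Types (x y : 'rV[R]_n) (b eps : R) (m : nat).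

(** The parameter [b] stands for 1/r^2: the weight w_r is [bump (r ^- 2) x ^+ n.+2]. *)
Definition bump b x : R := (1 + b * dotr x x)^-1.

Definition cutoff_bump b eps x : R := Num.max 0 (bump b x - eps).

Lemma bump_gt0 b x : 0 <= b -> 0 < bump b x.
Proof. by move=> b0; rewrite invr_gt0 ltr_pwDl// mulr_ge0// dotr_ge0. Qed.

Lemma bump_le1 b x : 0 <= b -> bump b x <= 1.
Proof.
move=> b0; have h : 1 <= 1 + b * dotr x x by rewrite lerDl mulr_ge0// dotr_ge0.
by rewrite invf_le1// (lt_le_trans ltr01).
Qed.

Lemma cutoff_bump_ge0 b eps x : 0 <= cutoff_bump b eps x.
Proof. by rewrite le_max lexx. Qed.

Lemma cutoff_bump_le b eps x : 0 <= b -> 0 <= eps -> cutoff_bump b eps x <= bump b x.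
Proof. by move=> b0 e0; rewrite ge_max (ltW (bump_gt0 _ b0))/= gerBl. Qed.

Lemma cutoff_bump_supp b eps x : 0 < b -> 0 < eps ->
  cutoff_bump b eps x != 0 -> `|x| <= Num.sqrt (b * eps)^-1.
Proof.
move=> b0 e0 h; have [h'|h'] := leP (bump b x - eps) 0.
  by move: h; rewrite /cutoff_bump max_l// eqxx.
have p0 : 0 < 1 + b * dotr x x by rewrite ltr_pwDl// mulr_ge0// ?dotr_ge0// ltW.
move: h'; rewrite subr_gt0 /bump -[ltRHS]mul1r ltr_pdivlMr// => h'.
have be0 : 0 < b * eps by rewrite mulr_gt0.
rewrite -[leLHS]ger0_norm// -sqrtr_sqr ler_wsqrtr//.
apply: (@le_trans _ _ (dotr x x)).
  by rewrite -sqr_enorm lerXn2r ?nnegrE ?enorm_ge0// norm_le_enorm.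
by rewrite -[leRHS]mul1r ler_pdivlMr//; nra.
Qed.

(** The tangent line at [c] lies below the power. In the induction, [a] times the previous tangent
    exceeds the next one by [m.+1%:R * c ^+ m * (a - c) ^+ 2]. *)
Lemma exprn_tangent (a c : R) m : 0 <= a -> 0 <= c ->
  c ^+ m.+1 + m.+1%:R * c ^+ m * (a - c) <= a ^+ m.+1.
Proof.
move=> a0 c0; elim: m => [|m IH]; first by rewrite !expr1 expr0; lra.
rewrite exprS [leRHS]exprS; have := ler_wpM2l a0 IH; apply: le_trans.
have cm : 0 <= c ^+ m by exact: exprn_ge0.
rewrite -subr_ge0 (_ : _ - _ = m.+1%:R * c ^+ m * (a - c) ^+ 2).
  by rewrite mulr_ge0 ?sqr_ge0// mulr_ge0.
by rewrite -[m.+2%:R]natr1 !exprS; ring.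
Qed.

Lemma bump_second_difference b x y : 0 <= b ->
  2 * bump b x - 2 * bump b x * Num.min 1 (b * dotr y y) <=
  bump b (x + y) + bump b (x - y).
Proof.
move=> b0; rewrite /bump; have := parallelogram x y.
have := dotr_ge0 (x + y); have := dotr_ge0 (x - y).
have := dotr_ge0 x; have := dotr_ge0 y.
set X := dotr x x; set Y := dotr y y; set P := dotr _ _; set Q := dotr _ _.
move=> Y0 X0 P0 Q0 PQ.
have bPQ : b * (P + Q) = b * (2 * (X + Y)) by rewrite [P + Q]addrC PQ.
pose A := 1 + b * X; pose t := b * Y.
have A1 : 1 <= A by rewrite lerDl mulr_ge0.
have t0 : 0 <= t by rewrite mulr_ge0.
have bP : 0 < 1 + b * P by rewrite ltr_pwDl// mulr_ge0.
have bQ : 0 < 1 + b * Q by rewrite ltr_pwDl// mulr_ge0.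
have At : 0 < A + t by rewrite (lt_le_trans ltr01)// (le_trans A1)// lerDl.
(* By the parallelogram law [A + t] is the average of the two denominators, so convexity of the
   inverse gives this intermediate bound. *)
apply: (@le_trans _ _ (2 / (A + t))); last first.
  have -> : (1 + b * Q)^-1 + (1 + b * P)^-1 =
      (2 * (A + t)) / ((1 + b * Q) * (1 + b * P)).
    have -> : 2 * (A + t) = (1 + b * Q) + (1 + b * P).
      by rewrite /A /t; lra.
    by field; rewrite !gt_eqF.
  rewrite ler_pdivlMr ?mulr_gt0// mulrAC ler_pdivrMr//.
  have -> : A + t = ((1 + b * Q) + (1 + b * P)) / 2 by rewrite /A /t; lra.
  move: (1 + b * Q) (1 + b * P) => U V;
  have := sqr_ge0 (U - V); nra.
(* What remains is (1 - min(1, t)) (A + t) <= A. It is clear for t >= 1; for t < 1 the difference is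
   t (A + t - 1), nonnegative because A >= 1. *)
rewrite -/A -/t; have -> : 2 * A^-1 - 2 * A^-1 * Num.min 1 t =
  2 * (A^-1 * (1 - Num.min 1 t)) by ring.
rewrite ler_wpM2l// ler_pdivrMl ?(lt_le_trans ltr01)//.
rewrite ler_pdivlMr//.
have [h|h] := leP 1 t; first by nra.
nra.
Qed.

(** Tangent lines bound the left side by [m.+2%:R * g ^+ m.+1] times minus the second difference of
    the truncated function. This is zero if [g = 0]. Otherwise [g] equals [bump b x - eps] exactly,
    while the values at [x + y] and [x - y] are at least the shifted bumps: the constants cancel and
    the bound for [bump] applies. *)
Lemma cutoff_bump_second_difference b eps m x y : 0 <= b -> 0 <= eps ->
  - (cutoff_bump b eps (x + y) ^+ m.+2 + cutoff_bump b eps (x - y) ^+ m.+2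
     - 2 * cutoff_bump b eps x ^+ m.+2) <=
  2 * m.+2%:R * bump b x ^+ m.+2 * Num.min 1 (b * dotr y y).
Proof.
move=> b0 e0; set g := cutoff_bump b eps x.
have g0 : 0 <= g by exact: cutoff_bump_ge0.
have gb : g <= bump b x by exact: cutoff_bump_le.
have h0 : 0 < bump b x by exact: bump_gt0.
have min0 : 0 <= Num.min 1 (b * dotr y y).
  by rewrite le_min ler01 mulr_ge0// dotr_ge0.
have := exprn_tangent m.+1 (cutoff_bump_ge0 b eps (x + y)) g0.
have := exprn_tangent m.+1 (cutoff_bump_ge0 b eps (x - y)) g0.
set gp := cutoff_bump b eps (x + y); set gm := cutoff_bump b eps (x - y).
move=> tm tp.
apply: (@le_trans _ _ (m.+2%:R * g ^+ m.+1 * (2 * g - gp - gm))); first by lra.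
rewrite (_ : _ * bump b x ^+ m.+2 * _ = m.+2%:R * (bump b x ^+ m.+1 *
  (2 * bump b x * Num.min 1 (b * dotr y y)))); last by rewrite [in LHS]exprS; ring.
rewrite -mulrA ler_wpM2l//.
have [gE|gE] := eqVneq g 0.
  by rewrite gE expr0n mul0r !mulr_ge0// ?exprn_ge0// ltW.
have gE' : g = bump b x - eps.
  by move: gE; rewrite /g /cutoff_bump; case: leP; rewrite ?eqxx.
have H := bump_second_difference x y b0.
have Hp : bump b (x + y) - eps <= gp by rewrite le_max lexx orbT.
have Hm : bump b (x - y) - eps <= gm by rewrite le_max lexx orbT.
have G : 2 * g - gp - gm <= 2 * bump b x * Num.min 1 (b * dotr y y) by lra.
apply: (@le_trans _ _ (g ^+ m.+1 * (2 * bump b x * Num.min 1 (b * dotr y y)))).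
  by rewrite ler_wpM2l// exprn_ge0.
rewrite ler_wpM2r// ?mulr_ge0// ?(ltW h0)//.
by rewrite lerXn2r ?nnegrE// ltW.
Qed.

Lemma measurable_dotr : measurable_fun setT (fun x : 'rV[R]_n => dotr x x).
Proof.
by apply: measurable_sum => i; apply: measurable_funM; exact: measurable_coord_rV.
Qed.

Lemma measurable_bump b : 0 <= b -> measurable_fun setT (bump b).
Proof.
move=> b0; rewrite (_ : bump b = fun x => (1 + b * dotr x x) `^ (-1)).
  apply: (measurableT_comp (measurable_powR (-1))); apply: measurable_funD => //.
  by apply: measurable_funM => //; exact: measurable_dotr.
by apply/funext => x; rewrite powR_inv1// addr_ge0// mulr_ge0// dotr_ge0.
Qed.

Lemma measurable_cutoff_bump b eps : 0 <= b -> measurable_fun setT (cutoff_bump b eps).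
Proof.
move=> b0; apply: measurable_maxr => //.
by apply: measurable_funB => //; exact: measurable_bump.
Qed.

End test_function.

(** The constant depends on [n], [b] and [c] alone, so the dependence on [r] is explicit. The
    estimates below, for the weights and for the kernel, are instances of it. *)
Lemma integral_le_two_powers (R : realType) n (b c : R) : (0 < n)%N ->
  0 <= b < n%:R -> n%:R < c ->
  exists2 C, 0 <= C & forall (f : 'rV[R]_n -> R) (r A B : R),
    0 < r -> 0 <= A -> 0 <= B ->
    measurable_fun setT f -> (forall x, 0 <= f x) ->
    (forall x, `|x| <= r -> f x <= A * `|x| `^ (- b)) ->
    (forall x, r < `|x| -> f x <= B * `|x| `^ (- c)) ->
    (\int[@lebesgue_rV R n]_x (f x)%:E <=
      (C * (A * r `^ (n%:R - b) + B * r `^ (n%:R - c)))%:E)%E.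
Proof.
move=> n0 bn nc.
have [C1 C10 H1] := integral_norm_powR_near n0 bn.
have [C2 C20 H2] := integral_norm_powR_far n0 nc.
exists (C1 + C2); first by rewrite addr_ge0.
move=> f r A B r0 A0 B0 mf f0 fnear ffar.
pose D1 := [set x : 'rV[R]_n | `|x| <= r].
pose D2 := [set x : 'rV[R]_n | r < `|x| ].
have mD1 : measurable D1 by exact: measurable_cube.
have mD2 : measurable D2 by exact: measurable_cubeC.
have DT : [set: 'rV[R]_n] = D1 `|` D2.
  by apply/seteqP; split => // x _; have [?|?] := leP `|x| r; [left|right].
have mfE D : measurable_fun D (fun x : 'rV[R]_n => (f x)%:E).
  by apply/measurable_EFinP; exact: measurable_funTS.
rewrite DT ge0_integral_setU//; last 2 first.
- by move=> x _; rewrite lee_fin.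
- by apply/disj_setPS => x [/= x1]; rewrite /D2/= ltNge x1.
have step (D : set 'rV[R]_n) (K e C t : R) : measurable D -> 0 <= K ->
    (forall x, D x -> f x <= K * `|x| `^ e) ->
    (\int[@lebesgue_rV R n]_(x in D) (`|x| `^ e)%:E <= (C * t)%:E)%E ->
    (\int[@lebesgue_rV R n]_(x in D) (f x)%:E <= (C * (K * t))%:E)%E.
  move=> mD K0 fD iD.
  have mp : measurable_fun D (fun x : 'rV[R]_n => (`|x| `^ e)%:E).
    by apply/measurable_EFinP; exact: measurable_norm_powR.
  apply: (@le_trans _ _ (\int[@lebesgue_rV R n]_(x in D) (K%:E * (`|x| `^ e)%:E))%E).
    apply: ge0_le_integral => //.
    - by move=> x _; rewrite lee_fin.
    - exact: measurable_funeM.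
  rewrite ge0_integralZl//.
  by rewrite mulrCA [leRHS]EFinM lee_wpmul2l.
have h1 := step D1 A (- b) C1 (r `^ (n%:R - b)) mD1 A0 fnear (H1 r r0).
have h2 := step D2 B (- c) C2 (r `^ (n%:R - c)) mD2 B0 ffar (H2 r r0).
apply: (le_trans (leeD h1 h2)); rewrite -EFinD lee_fin.
have := powR_ge0 r (n%:R - b); have := powR_ge0 r (n%:R - c).
set X := r `^ _; set Y := r `^ _ => X0 Y0.
have AY : 0 <= A * Y by rewrite mulr_ge0.
have BX : 0 <= B * X by rewrite mulr_ge0.
nra.
Qed.

(** * Integrals of the weights *)

Section bump_integrals.
Context {R : realType} {n : nat}.
Context (n0 : (0 < n)%N).
Implicit Types (x : 'rV[R]_n) (r : R).

Lemma bump_le_far r x : 0 < r -> 0 < `|x| -> bump (r ^- 2) x <= r ^+ 2 * `|x| `^ (- 2).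
Proof.
move=> r0 x0; have r2 : 0 < r ^- 2 by rewrite invr_gt0 exprn_gt0.
rewrite /bump powRN powR_mulrn// -[r ^+ 2 in leRHS]invrK -invfM lef_pV2 ?posrE.
- apply: (@le_trans _ _ (r ^- 2 * dotr x x)); last first.
    by rewrite lerDr.
  rewrite ler_pM2l// -sqr_enorm lerXn2r ?nnegrE ?enorm_ge0//.
  exact: norm_le_enorm.
- by rewrite ltr_pwDl// mulr_ge0// ?dotr_ge0// ltW.
- by rewrite mulr_gt0// exprn_gt0.
Qed.

Lemma bump_pow_le_far r x m : 0 < r -> 0 < `|x| ->
  bump (r ^- 2) x ^+ m <= r ^+ (2 * m) * `|x| `^ (- (2 * m)%:R).
Proof.
move=> r0 x0; have r2 : 0 <= r ^- 2 by rewrite ltW// invr_gt0 exprn_gt0.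
have -> : r ^+ (2 * m) * `|x| `^ (- (2 * m)%:R) = (r ^+ 2 * `|x| `^ (- 2)) ^+ m.
  rewrite exprMn -exprM; congr (_ * _).
  by rewrite !powRN !powR_mulrn// exprVn -exprM.
by rewrite lerXn2r ?nnegrE ?mulr_ge0 ?exprn_ge0 ?powR_ge0 ?bump_le_far ?ltW// bump_gt0.
Qed.

(** The weight is at most 1 within radius [r] and at most (r/|x|)^(2m) beyond it; each range
    contributes a multiple of [r ^+ n]. *)
Lemma integral_bump_pow m : (n < 2 * m)%N ->
  exists2 C, 0 <= C & forall r, 0 < r ->
    (\int[@lebesgue_rV R n]_x (bump (r ^- 2) x ^+ m)%:E <= (C * r ^+ n)%:E)%E.
Proof.
move=> nm; have [||C C0 H] := @integral_le_two_powers R n 0 (2 * m)%:R n0.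
- by rewrite lexx ltr0n.
- by rewrite ltr_nat.
exists (C * 2); first by rewrite mulr_ge0.
move=> r r0; have r0' := ltW r0; have r2 : 0 <= r ^- 2 by rewrite ltW// invr_gt0 exprn_gt0.
have := H (fun x => bump (r ^- 2) x ^+ m) r 1 (r ^+ (2 * m)).
rewrite subr0 powR_mulrn// => /(_ r0 ler01).
have -> : 1 * r ^+ n + r ^+ (2 * m) * r `^ (n%:R - (2 * m)%:R) = 2 * r ^+ n.
  have -> : r ^+ (2 * m) * r `^ (n%:R - (2 * m)%:R) = r ^+ n.
    rewrite powRD; last by rewrite (gt_eqF r0) implybT.
    rewrite powRN !powR_mulrn// mulrCA mulfV ?mulr1// expf_eq0 gt_eqF ?andbF//.
  by ring.
rewrite mulrA; apply.
- by rewrite exprn_ge0// ltW.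
- by apply: measurable_funX; exact: measurable_bump.
- by move=> x; rewrite exprn_ge0// ltW// bump_gt0.
- move=> x _; rewrite oppr0 powRr0 mulr1 exprn_ile1//; first by rewrite ltW// bump_gt0.
  exact: bump_le1.
- by move=> x rx; apply: bump_pow_le_far => //; exact: lt_trans rx.
Qed.

(** As finiteness suffices, the split is at radius 1 and [sigma] is raised to 2. Since 1 + |x| is at
    most 2 or at most 2|x|, a factor 4 appears. The far integrand decays like |x|^(2-2m), which
    fixes the condition on [m]. *)
Lemma integral_growth_bump_lty m (C sigma : R) (u : 'rV[R]_n -> R) r :
  (n + 2 < 2 * m)%N -> 0 <= sigma <= 2 -> 0 <= C ->
  measurable_fun setT u -> (forall x, 0 <= u x) ->
  (forall x, u x <= C * (1 + `|x|) `^ sigma) -> 0 < r ->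
  (\int[@lebesgue_rV R n]_x (u x * bump (r ^- 2) x ^+ m)%:E < +oo)%E.
Proof.
move=> nm /andP[s0 s2] C0 mu u0 uC r0.
have r2 : 0 <= r ^- 2 by rewrite ltW// invr_gt0 exprn_gt0.
have [||K K0 H] := @integral_le_two_powers R n 0 ((2 * m)%:R - 2) n0.
- by rewrite lexx ltr0n.
- by rewrite ltrBrDr -natrD ltr_nat.
apply: le_lt_trans (H _ 1 (C * 4) (C * 4 * r ^+ (2 * m)) _ _ _ _ _ _ _) (ltry _) => //.
- by rewrite mulr_ge0.
- by rewrite !mulr_ge0// exprn_ge0// ltW.
- by apply: measurable_funM => //; apply: measurable_funX; exact: measurable_bump.
- by move=> x; rewrite mulr_ge0// exprn_ge0// ltW// bump_gt0.
- move=> x x1; rewrite oppr0 powRr0 mulr1.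
  rewrite -[leRHS]mulr1 ler_pM// ?exprn_ge0 ?(ltW (bump_gt0 _ _))//; last first.
    by rewrite exprn_ile1 ?(ltW (bump_gt0 _ _)) ?bump_le1.
  rewrite (le_trans (uC x))// ler_wpM2l//.
  apply: (@le_trans _ _ ((1 + `|x|) `^ 2)).
    by apply: ler_powR => //; rewrite lerDl.
  rewrite powR_mulrn ?addr_ge0// (_ : 4 = 2 ^+ 2); last by ring.
  by rewrite lerXn2r ?nnegrE ?addr_ge0//; lra.
- move=> x x1; have x0 : 0 < `|x| by rewrite (lt_trans ltr01).
  rewrite opprB powRD; last by rewrite (gt_eqF x0) implybT.
  rewrite powR_mulrn//.
  rewrite (_ : C * 4 * _ * _ = (C * 4 * `|x| ^+ 2) *
    (r ^+ (2 * m) * `|x| `^ (- (2 * m)%:R))); last by ring.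
  rewrite ler_pM// ?exprn_ge0 ?(ltW (bump_gt0 _ _))//; last exact: bump_pow_le_far.
  rewrite (le_trans (uC x))// -mulrA ler_wpM2l//.
  apply: (@le_trans _ _ ((1 + `|x|) `^ 2)).
    by apply: ler_powR => //; rewrite lerDl.
  rewrite powR_mulrn ?addr_ge0// (_ : 4 * `|x| ^+ 2 = (2 * `|x|) ^+ 2); last by ring.
  by rewrite lerXn2r ?nnegrE ?addr_ge0// ?mulr_ge0//; lra.
Qed.

End bump_integrals.

(** Against the kernel, |y|^2 becomes the power -(n + 2s - 2), integrable at the origin because s <
    1, and |y|^sigma becomes -(n + 2s - sigma), integrable at infinity because sigma < 2s. With
    [2 <= n] the number n + 2s - 2 is nonnegative, as the two-power bound asks. *)
Lemma kernel_integral_le (R : realType) n (s sigma D : R) (k : 'rV[R]_n -> R) :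
  (2 <= n)%N -> 0 < s < 1 -> sigma < 2 * s -> 0 <= D ->
  measurable_fun setT k ->
  (forall y, 0 <= k y <= D * `|y| `^ (- (n%:R + 2 * s))) ->
  exists2 C, 0 <= C & forall (g : 'rV[R]_n -> R) (r A B : R),
    0 < r -> 0 <= A -> 0 <= B ->
    measurable_fun setT g -> (forall x, 0 <= g x) ->
    (forall x, `|x| <= r -> g x <= A * `|x| ^+ 2) ->
    (forall x, r < `|x| -> g x <= B * `|x| `^ sigma) ->
    (\int[@lebesgue_rV R n]_x (g x * k x)%:E <=
      (C * (A * r `^ (2 - 2 * s) + B * r `^ (sigma - 2 * s)))%:E)%E.
Proof.
move=> n2 /andP[s0 s1] ss D0 mk kD.
have n0 : (0 < n)%N by exact: leq_trans n2.
have n2' : 2 <= n%:R :> R by rewrite (ler_nat R 2).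
have [||C C0 H] := @integral_le_two_powers R n (n%:R + 2 * s - 2)
  (n%:R + 2 * s - sigma) n0.
- by apply/andP; split; lra.
- by lra.
exists (C * D); first by rewrite mulr_ge0.
move=> g r A B r0 A0 B0 mg g0 gnear gfar.
have := H (fun x => g x * k x) r (A * D) (B * D) r0.
have -> : n%:R - (n%:R + 2 * s - 2) = 2 - 2 * s by ring.
have -> : n%:R - (n%:R + 2 * s - sigma) = sigma - 2 * s by ring.
rewrite (_ : C * D * _ = C * (A * D * r `^ (2 - 2 * s) + B * D * r `^ (sigma - 2 * s)));
  last by ring.
apply.
- by rewrite mulr_ge0.
- by rewrite mulr_ge0.
- exact: measurable_funM.
- by move=> x; rewrite mulr_ge0//; have /andP[] := kD x.
- move=> x xr; have /andP[k0 kx] := kD x.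
  (* Powers do not add up at the origin; there [g] vanishes by its quadratic bound. *)
  have [x0|x0] := eqVneq x 0.
    have /eqP g00 : g x == 0.
      by rewrite eq_le g0 andbT (le_trans (gnear x xr))// x0 normr0 expr0n mulr0.
    by rewrite g00 mul0r mulr_ge0 ?powR_ge0// mulr_ge0.
  apply: (le_trans (ler_pM (g0 x) k0 (gnear x xr) kx)).
  rewrite (_ : - (n%:R + 2 * s - 2) = 2 - (n%:R + 2 * s)); last by ring.
  rewrite powRD ?normr_eq0 ?x0 ?implybT// powR_mulrn//.
  by rewrite le_eqVlt; apply/orP; left; apply/eqP; ring.
- move=> x xr; have /andP[k0 kx] := kD x; have x0 := lt_trans r0 xr.
  apply: (le_trans (ler_pM (g0 x) k0 (gfar x xr) kx)).
  rewrite (_ : - (n%:R + 2 * s - sigma) = sigma - (n%:R + 2 * s)); last by ring.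
  rewrite powRD ?(gt_eqF x0) ?implybT//.
  by rewrite le_eqVlt; apply/orP; left; apply/eqP; ring.
Qed.

(** * The weak inequality *)

Lemma continuous_measurable_rV (R : realType) n (f : 'rV[R]_n -> R) :
  continuous f -> measurable_fun setT f.
Proof.
move=> /continuousP cf; apply: (measurability _ (RGenOpens.measurableE R)) => //.
move=> _ [_ [a [b ->] <-]]; rewrite setTI; apply: open_measurable_rV.
by apply: cf; exact: interval_open.
Qed.

Definition second_difference (R : realType) n (u : 'rV[R]_n -> R) (x y : 'rV[R]_n) : R :=
  u (x + y) + u (x - y) - 2 * u x.

Section dominated_by_bump.
Context {R : realType} {n : nat} (n0 : (0 < n)%N) {m : nat} (nm : (n < 2 * m)%N).
Context {r : R} (r0 : 0 < r).

Lemma integrable_le_bump (f : 'rV[R]_n -> R) (K : R) :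
  measurable_fun setT f -> (forall x, `|f x| <= K * bump (r ^- 2) x ^+ m) ->
  (@lebesgue_rV R n).-integrable setT (EFin \o f).
Proof.
move=> mf fK; have r2 : 0 <= r ^- 2 by rewrite ltW// invr_gt0 exprn_gt0.
have b0 x : 0 <= bump (r ^- 2) x ^+ m by rewrite exprn_ge0// ltW// bump_gt0.
have mb : measurable_fun setT (fun x : 'rV[R]_n => bump (r ^- 2) x ^+ m).
  by apply: measurable_funX; exact: measurable_bump.
have ib : (@lebesgue_rV R n).-integrable setT (fun x : 'rV[R]_n => (bump (r ^- 2) x ^+ m)%:E).
  apply/integrableP; split; first exact/measurable_EFinP.
  under eq_integral do rewrite gee0_abs ?lee_fin//.
  have [C _ H] := @integral_bump_pow R n n0 m nm.
  by rewrite (le_lt_trans (H r r0))// ltry.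
apply: le_integrable (integrableZl measurableT K ib) => //.
  exact/measurable_EFinP.
by move=> x _; rewrite -EFinM/= lee_fin (le_trans (fK x))// ler_norm.
Qed.

End dominated_by_bump.

(** Since [sigma <= 2], the minimum is |y|^2 for |y| <= 1, where the C^2 bound is used, and
    |y|^sigma beyond, where growth is. It serves as the dominating function in [y], uniformly for
    [x] in a bounded set. *)
Lemma second_difference_le_min (R : realType) n (u : 'rV[R]_n -> R) (C sigma B : R) :
  Ck 2 u -> 0 <= B -> 0 <= sigma <= 2 -> 0 <= C ->
  (forall x, `|u x| <= C * (1 + `|x|) `^ sigma) ->
  exists2 K, 0 <= K & forall x y, `|x| <= B ->
    `|second_difference u x y| <= K * Num.min (`|y| ^+ 2) (`|y| `^ sigma).
Proof.
move=> Cku B0 /andP[s0 s2] C0 uC.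
have [M M0 MP] := second_difference_le B Cku.
(* For |y| > 1, each of the points z = x, x + y, x - y has 1 + |z| <= 1 + B + |y| <= (2 + B) |y|;
   the second difference involves four such values, u(x) being counted twice. *)
pose K := M + 4 * C * (2 + B) `^ sigma; exists K.
  by rewrite addr_ge0// !mulr_ge0// powR_ge0.
have K0 : 0 <= 4 * C * (2 + B) `^ sigma by rewrite !mulr_ge0// powR_ge0.
move=> x y xB; have [y1|y1] := leP `|y| 1.
  have -> : Num.min (`|y| ^+ 2) (`|y| `^ sigma) = `|y| ^+ 2.
    rewrite min_l//; have [->|y0] := eqVneq y 0.
      by rewrite normr0 expr0n powR_ge0.
    by rewrite -powR_mulrn// ger_powR// normr_gt0 y0.
  by rewrite (le_trans (MP x y xB y1))// ler_wpM2r ?sqr_ge0// lerDl.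
have y0 : 1 <= `|y| := ltW y1.
have -> : Num.min (`|y| ^+ 2) (`|y| `^ sigma) = `|y| `^ sigma.
  by rewrite min_r// -powR_mulrn// ler_powR.
apply: (@le_trans _ _ (4 * C * (2 + B) `^ sigma * `|y| `^ sigma)); last first.
  by rewrite ler_wpM2r ?powR_ge0// lerDr.
have zu (z : 'rV[R]_n) : `|z| <= B + `|y| -> `|u z| <= C * ((2 + B) `^ sigma * `|y| `^ sigma).
  move=> zB; rewrite (le_trans (uC z))// ler_wpM2l// -powRM ?addr_ge0//.
  by apply: ge0_ler_powR => //; rewrite ?nnegrE ?mulr_ge0 ?addr_ge0//; nra.
have h1 := zu (x + y) (le_trans (ler_normD _ _) (lerD xB (lexx _))).
have h2 := zu (x - y) (le_trans (ler_normB _ _) (lerD xB (lexx _))).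
have h3 : `|u x| <= C * ((2 + B) `^ sigma * `|y| `^ sigma).
  by apply: zu; rewrite (le_trans xB)// lerDl.
rewrite /second_difference (le_trans (ler_normB _ _))//.
rewrite (le_trans (lerD (ler_normD _ _) (lexx _)))// normrM ger0_norm//.
lra.
Qed.

Lemma measurable_shift_rV (R : realType) n (f : 'rV[R]_n -> R) (v : 'rV[R]_n) :
  measurable_fun setT f ->
  measurable_fun setT (fun x : 'rV[R]_n => f (x + v)).
Proof.
move=> mf; under eq_fun do rewrite -[X in X + v]scale1r.
by apply: (measurableT_comp mf); exact: measurable_affine_rV.
Qed.

Section cutoff_integrals.
Context {R : realType} {n : nat} (n0 : (0 < n)%N) (m : nat) (nm : (n < 2 * m.+2)%N).
Context {u : 'rV[R]_n -> R} (cu : continuous u) (u0 : forall x, 0 <= u x).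
Context {r eps : R} (r0 : 0 < r) (e0 : 0 < eps).

Let b := r ^- 2.
Let phi (x : 'rV[R]_n) := cutoff_bump b eps x ^+ m.+2.
Let b0 : 0 < b. Proof. by rewrite invr_gt0 exprn_gt0. Qed.
Let phi0 x : 0 <= phi x. Proof. by rewrite exprn_ge0// cutoff_bump_ge0. Qed.
Let mphi : measurable_fun setT phi.
Proof. by apply: measurable_funX; apply: measurable_cutoff_bump; exact: ltW. Qed.
Let mu : measurable_fun setT u. Proof. exact: continuous_measurable_rV. Qed.

Lemma cutoff_le_bump x : phi x <= bump b x ^+ m.+2.
Proof.
rewrite lerXn2r ?nnegrE ?cutoff_bump_ge0 ?(ltW (bump_gt0 _ _)) ?(ltW b0)//.
by apply: cutoff_bump_le; exact: ltW.
Qed.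

Lemma integrable_cutoff_mul (f : 'rV[R]_n -> R) (K : R) : 0 <= K ->
  measurable_fun setT f ->
  (forall x, `|x| <= Num.sqrt (b * eps)^-1 -> `|f x| <= K) ->
  (@lebesgue_rV R n).-integrable setT (EFin \o (fun x => f x * phi x)).
Proof.
move=> K0 mf fK; apply: (integrable_le_bump n0 nm r0 (K := K)).
  exact: measurable_funM.
move=> x; rewrite normrM (ger0_norm (phi0 x)).
have [px|px] := eqVneq (phi x) 0.
  by rewrite px mulr0 mulr_ge0// exprn_ge0// ltW// bump_gt0// ltW.
apply: ler_pM => //; last exact: cutoff_le_bump.
apply: fK; apply: cutoff_bump_supp => //.
by move: px; rewrite expf_eq0.
Qed.

(** At fixed [y], translations by [y] and [- y] move the second difference from [u] to the cutoff
    weight, where the pointwise bound holds. *)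
Lemma integral_second_difference_cutoff_le y :
  (\int[@lebesgue_rV R n]_x (- (second_difference u x y) * phi x)%:E <=
   (2 * m.+2%:R * Num.min 1 (b * dotr y y))%:E *
   \int[@lebesgue_rV R n]_x (u x * bump b x ^+ m.+2)%:E)%E.
Proof.
have int w : (@lebesgue_rV R n).-integrable setT (EFin \o (fun x => u (x + w) * phi x)).
  have [K K0 KP] := continuous_bounded_cube (Num.sqrt (b * eps)^-1 + `|w|) cu.
  apply: (integrable_cutoff_mul K0); first exact: measurable_shift_rV.
  by move=> x xB; apply: KP; rewrite (le_trans (ler_normD _ _))// lerD2r.
have int2 : (@lebesgue_rV R n).-integrable setT (EFin \o (fun x => 2 * u x * phi x)).
  have [K K0 KP] := continuous_bounded_cube (Num.sqrt (b * eps)^-1) cu.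
  apply: (@integrable_cutoff_mul _ (2 * K)); first by rewrite mulr_ge0.
    exact: measurable_funM.
  by move=> x xB; rewrite normrM ger0_norm// ler_wpM2l// KP.
have sh w : (\int[@lebesgue_rV R n]_x (u (x + w) * phi x)%:E =
             \int[@lebesgue_rV R n]_x (u x * phi (x - w))%:E)%E.
  rewrite -(@ge0_integral_shift _ _ w (fun x => (u x * phi (x - w))%:E)).
  - by apply: eq_integral => x _; rewrite addrK.
  - by apply/measurable_EFinP; apply: measurable_funM => //; exact: measurable_shift_rV.
  - by move=> x; rewrite lee_fin mulr_ge0.
have mup w : measurable_fun setT (fun x => (u x * phi (x + w))%:E).
  by apply/measurable_EFinP; apply: measurable_funM => //; exact: measurable_shift_rV.
have up0 w x : (0 <= (u x * phi (x + w))%:E)%E by rewrite lee_fin mulr_ge0.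
have mub : measurable_fun setT (fun x => (u x * bump b x ^+ m.+2)%:E).
  apply/measurable_EFinP; apply: measurable_funM => //.
  by apply: measurable_funX; apply: measurable_bump; exact: ltW.
have ub0 x : (0 <= (u x * bump b x ^+ m.+2)%:E)%E.
  by rewrite lee_fin mulr_ge0// exprn_ge0// ltW// bump_gt0// ltW.
set c := 2 * m.+2%:R * _.
have c0 : 0 <= c.
  by rewrite !mulr_ge0// le_min ler01 mulr_ge0 ?dotr_ge0// ltW.
have -> : (\int[@lebesgue_rV R n]_x (- (second_difference u x y) * phi x)%:E =
  \int[@lebesgue_rV R n]_x (2 * u x * phi x)%:E -
  \int[@lebesgue_rV R n]_x (u (x + y) * phi x)%:E -
  \int[@lebesgue_rV R n]_x (u (x - y) * phi x)%:E)%E.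
  have int1 : (@lebesgue_rV R n).-integrable setT
      (EFin \o (fun x => 2 * u x * phi x - u (x + y) * phi x)).
    by have := integrableB measurableT int2 (int y).
  have /= <- := integralB_EFin measurableT int2 (int y).
  under [in RHS]eq_integral do rewrite -EFinB.
  have /= <- := integralB_EFin measurableT int1 (int (- y)).
  by apply: eq_integral => x _; rewrite -EFinB /second_difference; congr EFin; ring.
(* The integral on the right may be infinite, but the subtracted ones are finite: moved across, they
   leave an inequality between integrals of nonnegative functions. *)
rewrite leeBlDr; last by apply: integrable_fin_num => //; exact: int.
rewrite leeBlDr; last by apply: integrable_fin_num => //; exact: int.
rewrite !sh opprK -ge0_integralZl//.
rewrite -ge0_integralD//; last 2 first.
- by move=> x _; rewrite mule_ge0.
- exact: measurable_funeM.
rewrite -ge0_integralD//; last 2 first.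
- by move=> x _; rewrite adde_ge0// mule_ge0.
- by apply: emeasurable_funD => //; exact: measurable_funeM.
apply: ge0_le_integral => //.
- by move=> x _; rewrite lee_fin mulr_ge0// mulr_ge0.
- by apply/measurable_EFinP; apply: measurable_funM => //; exact: measurable_funM.
- apply: emeasurable_funD => //; apply: emeasurable_funD => //.
  exact: measurable_funeM.
move=> x _; rewrite -EFinM -!EFinD lee_fin.
have := cutoff_bump_second_difference m x y (ltW b0) (ltW e0).
rewrite -/(phi x) -/(phi (x + y)) -/(phi (x - y)) => h.
have := ler_wpM2l (u0 x) h; rewrite /c.
set A := bump b x ^+ m.+2; set B := Num.min _ _; lra.
Qed.

End cutoff_integrals.

Section weak_formulation.
Context {R : realType} {n : nat} (n2 : (2 <= n)%N).
Context {s sigma C D : R} (s01 : 0 < s < 1) (ss : 0 <= sigma < 2 * s) (C0 : 0 <= C)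
  (D0 : 0 <= D).
Context {k u G : 'rV[R]_n -> R} (mk : measurable_fun setT k)
  (kD : forall y, 0 <= k y <= D * `|y| `^ (- (n%:R + 2 * s)))
  (Cku : Ck 2 u) (u0 : forall x, 0 <= u x)
  (uC : forall x, `|u x| <= C * (1 + `|x|) `^ sigma)
  (mG : measurable_fun setT G) (G0 : forall x, 0 <= G x)
  (GL : forall x, G x <=
    - \int[@lebesgue_rV R n]_y (second_difference u x y * k y)).

Let leb : {sigma_finite_measure set 'rV[R]_n -> \bar R} := @lebesgue_rV R n.
Let n0 : (0 < n)%N. Proof. exact: leq_trans n2. Qed.
Let nm : (n + 2 < 2 * n.+2)%N.
Proof. by rewrite addn2 mul2n -addnn -[X in (X < _)%N]addn0 ltn_add2l. Qed.
Let nm' : (n < 2 * n.+2)%N.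
Proof. by apply: leq_trans nm; rewrite ltnS leq_addr. Qed.
Let sigma2 : 0 <= sigma <= 2.
Proof. by case/andP: s01 => _ s1; case/andP: ss => -> /= ?; lra. Qed.
Let cu : continuous u. Proof. by case: Cku. Qed.
Let mu : measurable_fun setT u. Proof. exact: continuous_measurable_rV. Qed.

Lemma measurable_second_difference :
  measurable_fun setT (fun z : 'rV[R]_n * 'rV[R]_n => second_difference u z.1 z.2).
Proof.
have mD : measurable_fun setT (fun z : 'rV[R]_n * 'rV[R]_n => z.1 + z.2).
  apply: measurable_rVP => i; under eq_fun do rewrite mxE.
  apply: measurable_funD.
    exact: (measurableT_comp (measurable_coord_rV i) measurable_fst).
  exact: (measurableT_comp (measurable_coord_rV i) measurable_snd).
have mB : measurable_fun setT (fun z : 'rV[R]_n * 'rV[R]_n => z.1 - z.2).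
  apply: measurable_rVP => i; under eq_fun do rewrite !mxE.
  apply: measurable_funB.
    exact: (measurableT_comp (measurable_coord_rV i) measurable_fst).
  exact: (measurableT_comp (measurable_coord_rV i) measurable_snd).
apply: measurable_funB.
  by apply: measurable_funD; exact: measurableT_comp.
apply: measurable_funM => //.
by apply: (measurableT_comp mu); exact: measurable_fst.
Qed.

Lemma integral_growth_min_lty :
  (\int[leb]_y (Num.min (`|y| ^+ 2) (`|y| `^ sigma) * k y)%:E < +oo)%E.
Proof.
case/andP: ss => s0 s2; have [K K0 H] := kernel_integral_le n2 s01 s2 D0 mk kD.
have min0 (y : 'rV[R]_n) : 0 <= Num.min (`|y| ^+ 2) (`|y| `^ sigma).
  by rewrite le_min sqr_ge0 powR_ge0.
apply: le_lt_trans (H _ 1 1 1 _ _ _ _ _ _ _) (ltry _) => //.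
- apply: measurable_minr; last exact: measurable_norm_powR.
  by apply: measurable_funX; exact: measurable_norm_rV.
- by move=> y _; rewrite mul1r ge_min lexx.
- by move=> y _; rewrite mul1r ge_min lexx orbT.
Qed.

(** The bound |y|^2/r^2 within radius [r] and the bound 1 beyond it both integrate to a multiple of
    r^(-2s). The factor [n] comes from replacing the Euclidean length by the sup norm. *)
Lemma integral_min_le : exists2 K, 0 <= K & forall r, 0 < r ->
  (\int[leb]_y (Num.min 1 (r ^- 2 * dotr y y) * k y)%:E <= (K * r `^ (- (2 * s)))%:E)%E.
Proof.
have s2 : 0 < 2 * s by case/andP: s01 => ? _; rewrite mulr_gt0.
(* Used with growth exponent 0, admissible because [0 < 2 * s]. *)
have [K K0 H] := kernel_integral_le n2 s01 s2 D0 mk kD.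
exists (K * (n%:R + 1)); first by rewrite mulr_ge0// addr_ge0.
move=> r r0; have b0 : 0 <= r ^- 2 by rewrite ltW// invr_gt0 exprn_gt0.
have -> : K * (n%:R + 1) * r `^ (- (2 * s)) =
    K * ((n%:R * r ^- 2) * r `^ (2 - 2 * s) + 1 * r `^ (0 - 2 * s)).
  rewrite sub0r powRD ?(gt_eqF r0) ?implybT// powR_mulrn ?(ltW r0)//.
  by rewrite mulrA mulfVK ?expf_eq0 ?(gt_eqF r0)//; ring.
apply: H => //.
- by rewrite mulr_ge0.
- by apply: measurable_minr => //; apply: measurable_funM => //; exact: measurable_dotr.
- by move=> y; rewrite le_min ler01 mulr_ge0 ?dotr_ge0.
- move=> y _; rewrite (mulrC n%:R) -mulrA ge_min; apply/orP; right.
  by rewrite ler_wpM2l// dotr_le_norm.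
- by move=> y _; rewrite powRr0 mul1r ge_min lexx.
Qed.

(** The double integrand [F] is dominated by [K * phi x * w y], a product of integrable functions;
    the constant [K] is valid for [x] in the ball containing the support of [phi], and [F] vanishes
    elsewhere. Once the integrals are exchanged, the estimate at fixed [y] applies. *)
Lemma weak_supersolution_cutoff r eps : 0 < r -> 0 < eps ->
  (\int[leb]_x (G x * cutoff_bump (r ^- 2) eps x ^+ n.+2)%:E <=
   (2 * n.+2%:R)%:E * (\int[leb]_x (u x * bump (r ^- 2) x ^+ n.+2)%:E) *
   \int[leb]_y (Num.min 1 (r ^- 2 * dotr y y) * k y)%:E)%E.
Proof.
move=> r0 e0; have b0 : 0 < r ^- 2 by rewrite invr_gt0 exprn_gt0.
pose phi (x : 'rV[R]_n) := cutoff_bump (r ^- 2) eps x ^+ n.+2.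
have phi0 x : 0 <= phi x by rewrite exprn_ge0// cutoff_bump_ge0.
have mphi : measurable_fun setT phi.
  by apply: measurable_funX; apply: measurable_cutoff_bump; exact: ltW.
pose B := Num.sqrt (r ^- 2 * eps)^-1.
have phiB x : phi x != 0 -> `|x| <= B.
  by rewrite expf_eq0 => h; apply: cutoff_bump_supp.
have [K K0 KP] := second_difference_le_min Cku (sqrtr_ge0 _ : 0 <= B) sigma2 C0 uC.
pose w (y : 'rV[R]_n) := Num.min (`|y| ^+ 2) (`|y| `^ sigma) * k y.
have k0 y : 0 <= k y by case/andP: (kD y).
have w0 y : 0 <= w y by rewrite mulr_ge0// le_min sqr_ge0 powR_ge0.
have mw : measurable_fun setT w.
  apply: measurable_funM => //; apply: measurable_minr; last exact: measurable_norm_powR.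
  by apply: measurable_funX; exact: measurable_norm_rV.
have mwE : measurable_fun setT (EFin \o w) by exact/measurable_EFinP.
have iw : leb.-integrable setT (EFin \o w).
  apply/integrableP; split => //.
  under eq_integral do rewrite gee0_abs ?lee_fin//.
  exact: integral_growth_min_lty.
have msd x : measurable_fun setT (fun y => second_difference u x y * k y).
  apply: measurable_funM => //.
  exact: (measurableT_comp measurable_second_difference (pair1_measurable x)).
have sdw x y : `|x| <= B -> `|second_difference u x y * k y| <= K * w y.
  move=> xB; rewrite normrM (ger0_norm (k0 y)) /w mulrA ler_wpM2r//.
  exact: KP.
pose F (z : 'rV[R]_n * 'rV[R]_n) : \bar R :=
  (- second_difference u z.1 z.2 * phi z.1 * k z.2)%:E.
have mF : measurable_fun setT F.
  apply/measurable_EFinP; apply: measurable_funM.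
    apply: measurable_funM; last by apply: (measurableT_comp mphi); exact: measurable_fst.
    by apply: measurableT_comp => //; exact: measurable_second_difference.
  by apply: (measurableT_comp mk); exact: measurable_snd.
have Fle x y : (`|F (x, y)| <= (K * phi x * w y)%:E)%E.
  rewrite /F lee_fin/= mulrAC mulNr mulNr normrN normrM (ger0_norm (phi0 x)).
  have [p0|p0] := eqVneq (phi x) 0; first by rewrite p0 !(mulr0, mul0r).
  rewrite [leRHS](_ : _ = K * w y * phi x); last by ring.
  by rewrite ler_wpM2r// sdw// phiB.
have iphi : leb.-integrable setT (EFin \o phi).
  apply: (integrable_le_bump n0 nm' r0 (K := 1)) => // x.
  by rewrite mul1r ger0_norm//; exact: cutoff_le_bump.
have iF : (leb \x leb)%E.-integrable setT F.
  apply/integrable12ltyP => //.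
  apply: (@le_lt_trans _ _ (\int[leb]_x ((K * phi x)%:E * \int[leb]_y (w y)%:E))%E).
    have mI : measurable_fun setT (fun x => \int[leb]_y `|F (x, y)|)%E.
      apply: (@measurable_fun_fubini_tonelli_F _ _ _ _ _ leb (abse \o F)).
      - exact: measurableT_comp.
      - by move=> z /=.
    apply: ge0_le_integral => //.
    - by move=> x _; exact: integral_ge0.
    - apply: emeasurable_funM => //; apply/measurable_EFinP; exact: measurable_funM.
    - move=> x _; have Kp0 := mulr_ge0 K0 (phi0 x).
      rewrite -ge0_integralZl//; last by move=> y _; rewrite lee_fin.
      apply: ge0_le_integral => //.
      + apply: measurableT_comp => //.
        exact: (measurableT_comp mF (pair1_measurable x)).
      + exact: measurable_funeM.
  pose I := fine (\int[leb]_y (w y)%:E)%E.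
  have -> : (\int[leb]_y (w y)%:E)%E = I%:E.
    by rewrite fineK//; exact: (integrable_fin_num measurableT iw).
  under eq_integral do rewrite -EFinM mulrAC EFinM.
  have := integrableZl measurableT (K * I) iphi.
  move/(integrable_fin_num measurableT).
  rewrite ge0_fin_numE//; apply: integral_ge0 => x _.
  rewrite -EFinM lee_fin; apply: mulr_ge0 => //; apply: mulr_ge0 => //.
  by rewrite fine_ge0// integral_ge0// => y _; rewrite lee_fin.
have GF : (\int[leb]_x (G x * phi x)%:E <= \int[leb]_x \int[leb]_y F (x, y))%E.
  apply: ge0_le_integral => //.
  - by move=> x _; rewrite lee_fin mulr_ge0.
  - by apply/measurable_EFinP; exact: measurable_funM.
  - exact: (measurable_fubini_F iF).
  move=> x _; have [p0|p0] := eqVneq (phi x) 0.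
    rewrite p0 mulr0 (eq_integral (cst 0%E)) ?integral0// => y _.
    by rewrite /F/= p0 mulr0 mul0r.
  pose g (y : 'rV[R]_n) := second_difference u x y * k y.
  have isd : leb.-integrable setT (EFin \o g).
    apply: le_integrable (integrableZl measurableT K iw) => //.
      by apply/measurable_EFinP; exact: msd.
    move=> y _; rewrite -EFinM lee_fin (le_trans (sdw x y (phiB x p0)))//.
    exact: ler_norm.
  rewrite (eq_integral (fun y => ((- phi x)%:E * (EFin \o g) y)%E)); last first.
    by move=> y _; rewrite -EFinM /F/g/=; congr EFin; ring.
  rewrite integralZl//.
  (* [GL] speaks of the real-valued integral, which represents the extended one because the latter
     is finite. *)
  have /fineK <- := integrable_fin_num measurableT isd.
  rewrite -EFinM lee_fin mulNr -mulrN mulrC ler_wpM2l//.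
apply: (le_trans GF).
rewrite (@Fubini _ _ _ _ _ leb leb F iF).
set J := (\int[leb]_x (u x * _)%:E)%E.
have J0 : (0 <= J)%E.
  by apply: integral_ge0 => x _; rewrite lee_fin mulr_ge0// exprn_ge0// ltW// bump_gt0// ltW.
(* With [J] finite, the bound at fixed [y] is a real multiple of the integrable function [mn] and
   can be integrated in [y]. *)
have Jfin : J \is a fin_num.
  rewrite ge0_fin_numE//; apply: (integral_growth_bump_lty n0 nm sigma2 C0) => //.
  by move=> x; rewrite -(ger0_norm (u0 x)).
pose mn (y : 'rV[R]_n) : R := Num.min 1 (r ^- 2 * dotr y y) * k y.
have mn0 y : 0 <= mn y by rewrite mulr_ge0// le_min ler01 mulr_ge0 ?dotr_ge0// ltW.
have mmn : measurable_fun setT (EFin \o mn).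
  apply/measurable_EFinP; apply: measurable_funM => //; apply: measurable_minr => //.
  by apply: measurable_funM => //; exact: measurable_dotr.
have imn : leb.-integrable setT (EFin \o mn).
  apply/integrableP; split => //.
  under eq_integral do rewrite gee0_abs ?lee_fin//.
  have [K' _ H] := integral_min_le.
  exact: le_lt_trans (H r r0) (ltry _).
have JE : ((2 * n.+2%:R)%:E * J)%E = (2 * n.+2%:R * fine J)%:E.
  by rewrite [in RHS]EFinM fineK.
rewrite JE -[leRHS]integralZl//.
apply: le_integral => //.
- have iF' : (leb \x leb)%E.-integrable setT (fun z => F (z.2, z.1)).
    apply/integrable12ltyP; first by apply: (measurableT_comp mF); exact: measurable_fun_pair.
    by have := (integrable21ltyP leb leb mF).1 iF.
  exact: (integrable_fubini_F iF').
- exact: integrableZl.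
move=> y _.
have -> : (\int[leb]_x F (x, y) =
    (k y)%:E * \int[leb]_x (- (second_difference u x y) * phi x)%:E)%E.
  rewrite -integralZl//.
    by apply: eq_integral => x _; rewrite -EFinM /F/=; congr EFin; ring.
  have [K1 K10 K1P] := continuous_bounded_cube (B + `|y|) cu.
  apply: (@integrable_cutoff_mul _ _ n0 _ nm' _ eps r0 e0 _ (4 * K1)).
  - by rewrite mulr_ge0.
  - apply: measurableT_comp => //.
    exact: (measurableT_comp measurable_second_difference (pair2_measurable y)).
  move=> x xB; have yB : `|x| <= B + `|y| by rewrite (le_trans xB)// lerDl.
  have h1 := K1P (x + y) (le_trans (ler_normD _ _) (lerD xB (lexx _))).
  have h2 := K1P (x - y) (le_trans (ler_normB _ _) (lerD xB (lexx _))).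
  have h3 := K1P x yB.
  rewrite normrN /second_difference (le_trans (ler_normB _ _))//.
  rewrite (le_trans (lerD (ler_normD _ _) (lexx _)))// normrM ger0_norm//.
  lra.
apply: (@le_trans _ _ ((k y)%:E * ((2 * n.+2%:R * Num.min 1 (r ^- 2 * dotr y y))%:E * J))%E).
  rewrite lee_wpmul2l ?lee_fin//.
  exact: (integral_second_difference_cutoff_le n0 nm' cu u0 r0 e0).
rewrite -(fineK Jfin) -!EFinM lee_fin /mn /=.
by rewrite le_eqVlt; apply/orP; left; apply/eqP; ring.
Qed.

End weak_formulation.

(** * Monotone limits of the weights *)

Lemma cvg_harmonic_squeeze (R : realType) (v : nat -> R) (l c : R) :
  (forall j, l - c * j.+1%:R^-1 <= v j <= l) -> v @ \oo --> l.
Proof.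
move=> vl; apply: (@squeeze_cvgr _ _ _ _ (fun j => l - c * j.+1%:R^-1) (cst l)).
- by apply: nearW => j; exact: vl.
- rewrite -[X in _ --> X](subr0 l) -[X in _ - X](mulr0 c); apply: cvgB; first exact: cvg_cst.
  by apply: cvgM; [exact: cvg_cst|exact: cvg_harmonic].
- exact: cvg_cst.
Qed.

Lemma integral_le_nondecreasing d (T : measurableType d) (R : realType)
    (mu : {measure set T -> \bar R}) (h : nat -> T -> R) (f : T -> R) (M : \bar R) :
  (forall j, measurable_fun setT (h j)) -> (forall j x, 0 <= h j x) ->
  (forall x, nondecreasing_seq (h ^~ x)) -> (forall x, h ^~ x @ \oo --> f x) ->
  (forall j, (\int[mu]_x (h j x)%:E <= M)%E) -> (\int[mu]_x (f x)%:E <= M)%E.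
Proof.
move=> mh h0 nd hf hM.
have mE j : measurable_fun setT (fun x => (h j x)%:E) by exact/measurable_EFinP.
have hE0 j x : setT x -> (0 <= (h j x)%:E)%E by rewrite lee_fin.
have ndE x : setT x -> nondecreasing_seq (fun j => (h j x)%:E).
  by move=> _ a b ab; rewrite lee_fin; exact: nd.
have mc := @monotone_convergence _ T R mu setT measurableT (fun j x => (h j x)%:E)
  mE hE0 ndE.
have -> : (\int[mu]_x (f x)%:E = \int[mu]_x limn (fun j => (h j x)%:E))%E.
  apply: eq_integral => x _; apply/esym/cvg_lim => //.
  exact: cvg_EFin (nearW _ _) (hf x).
rewrite mc; apply: lime_le; last by apply: nearW => j; exact: hM.
apply: ereal_nondecreasing_is_cvgn => a b ab.
by apply: ge0_le_integral => // x _; [exact: hE0|exact: ndE].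
Qed.

Section bump_limits.
Context {R : realType} {n : nat}.
Implicit Types (x : 'rV[R]_n).

Lemma cvg_cutoff_bump (b : R) m x : 0 <= b ->
  (fun j => cutoff_bump b j.+1%:R^-1 x ^+ m) @ \oo --> bump b x ^+ m.
Proof.
move=> b0; apply: (cvg_comp _ (fun y : R => y ^+ m)); last exact: exprn_continuous.
apply: (@cvg_harmonic_squeeze _ _ _ 1) => j.
by rewrite cutoff_bump_le// mul1r /cutoff_bump le_max lexx orbT.
Qed.

(** With c = (r + j)^-2 one has 1 - c |x|^2 <= 1 / (1 + c |x|^2) <= 1, and c <= 1/(j + 1) because
    [1 <= r]. *)
Lemma cvg_bump (r : R) m x : 1 <= r ->
  (fun j => bump ((r + j%:R) ^- 2) x ^+ m) @ \oo --> (1 : R).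
Proof.
move=> r1; rewrite -[X in _ --> X](expr1n R m).
apply: (cvg_comp _ (fun y : R => y ^+ m)); last exact: exprn_continuous.
apply: (@cvg_harmonic_squeeze _ _ _ (dotr x x)) => j.
have j1 : 1 <= j.+1%:R :> R by rewrite ler1n.
have rj : j.+1%:R <= r + j%:R by rewrite -natr1 addrC lerD2r.
have b0 : 0 <= (r + j%:R) ^- 2.
  by rewrite invr_ge0 exprn_ge0// (le_trans _ rj).
rewrite bump_le1// andbT.
have bj : (r + j%:R) ^- 2 <= j.+1%:R^-1.
  rewrite lef_pV2 ?posrE ?exprn_gt0 ?(lt_le_trans _ rj)//.
  by rewrite (le_trans rj)// expr2 ler_peMl// (le_trans _ rj).
have d0 := dotr_ge0 x; set c := (r + j%:R) ^- 2 in b0 bj *.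
have cd : 0 <= c * dotr x x by rewrite mulr_ge0.
apply: (@le_trans _ _ (1 - c * dotr x x)).
  by rewrite lerB// mulrC ler_wpM2l.
rewrite /bump -[leRHS]mul1r ler_pdivlMr; last by lra.
nra.
Qed.

Lemma bump_le_bump (b c : R) x : 0 <= b <= c -> bump c x <= bump b x.
Proof.
move=> /andP[b0 bc]; have d0 := dotr_ge0 x.
have h : 0 <= b * dotr x x by rewrite mulr_ge0.
have h' : b * dotr x x <= c * dotr x x by rewrite ler_wpM2r.
by rewrite lef_pV2 ?posrE; lra.
Qed.

(** Along the radii r + j the weights increase to 1. The bound is asked from [r] on only, so that
    [r] can be chosen after other constants. *)
Lemma integral_bump_sup (f : 'rV[R]_n -> R) m (r : R) (M : \bar R) :
  measurable_fun setT f -> (forall x, 0 <= f x) -> 1 <= r ->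
  (forall t, r <= t ->
    (\int[@lebesgue_rV R n]_x (f x * bump (t ^- 2) x ^+ m)%:E <= M)%E) ->
  (\int[@lebesgue_rV R n]_x (f x)%:E <= M)%E.
Proof.
move=> mf f0 r1 fM.
have rj (j : nat) : 0 < r + j%:R by rewrite (lt_le_trans ltr01)// (le_trans r1)// lerDl.
have b0 (j : nat) : 0 <= (r + j%:R) ^- 2 by rewrite invr_ge0 exprn_ge0// ltW.
apply: (@integral_le_nondecreasing _ _ _ (@lebesgue_rV R n)
  (fun j x => f x * bump ((r + j%:R) ^- 2) x ^+ m)) => //.
- by move=> j; apply: measurable_funM => //; apply: measurable_funX; exact: measurable_bump.
- by move=> j x; rewrite mulr_ge0// exprn_ge0// ltW// bump_gt0.
- move=> x i j ij; rewrite ler_wpM2l// lerXn2r ?nnegrE ?(ltW (bump_gt0 _ _))//.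
  apply: bump_le_bump; rewrite b0/= lef_pV2 ?posrE ?exprn_gt0//.
  by rewrite lerXn2r ?nnegrE ?(ltW (rj _))// lerD2l ler_nat.
- move=> x; rewrite -[X in _ --> X]mulr1; apply: cvgM; first exact: cvg_cst.
  exact: cvg_bump.
- by move=> j; apply: fM; rewrite lerDl.
Qed.

End bump_limits.

(** The constant is that of [integral_min_le] and does not involve [eps], so it survives the
    monotone limit along [eps = j.+1%:R^-1]. *)
Lemma weak_supersolution (R : realType) n (s sigma C D : R) (k u G : 'rV[R]_n -> R) :
  (2 <= n)%N -> 0 < s < 1 -> 0 <= sigma < 2 * s -> 0 <= C -> 0 <= D ->
  measurable_fun setT k ->
  (forall y, 0 <= k y <= D * `|y| `^ (- (n%:R + 2 * s))) ->
  Ck 2 u -> (forall x, 0 <= u x) ->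
  (forall x, `|u x| <= C * (1 + `|x|) `^ sigma) ->
  measurable_fun setT G -> (forall x, 0 <= G x) ->
  (forall x, G x <= - \int[@lebesgue_rV R n]_y (second_difference u x y * k y)) ->
  exists2 K, 0 <= K & forall r, 0 < r ->
    (\int[@lebesgue_rV R n]_x (G x * bump (r ^- 2) x ^+ n.+2)%:E <=
     (K * r `^ (- (2 * s)))%:E *
     \int[@lebesgue_rV R n]_x (u x * bump (r ^- 2) x ^+ n.+2)%:E)%E.
Proof.
move=> n2 s01 ss C0 D0 mk kD Cku u0 uC mG G0 GL.
have [K K0 KP] := integral_min_le n2 s01 D0 mk kD.
exists (2 * n.+2%:R * K); first by rewrite !mulr_ge0.
move=> r r0; have b0 : 0 <= r ^- 2 by rewrite ltW// invr_gt0 exprn_gt0.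
apply: (@integral_le_nondecreasing _ _ _ (@lebesgue_rV R n)
  (fun j x => G x * cutoff_bump (r ^- 2) j.+1%:R^-1 x ^+ n.+2)).
- by move=> j; apply: measurable_funM => //; apply: measurable_funX; exact: measurable_cutoff_bump.
- by move=> j x; rewrite mulr_ge0// exprn_ge0// cutoff_bump_ge0.
- move=> x i j ij; rewrite ler_wpM2l// lerXn2r ?nnegrE ?cutoff_bump_ge0//.
  rewrite /cutoff_bump ge_max le_max lexx/= le_max; apply/orP; right.
  by rewrite lerB// lef_pV2 ?posrE// ler_nat.
- by move=> x; apply: cvgM; [exact: cvg_cst|exact: cvg_cutoff_bump].
move=> j.
have j0 : 0 < j.+1%:R^-1 :> R by rewrite invr_gt0.
have := weak_supersolution_cutoff n2 s01 ss C0 D0 mk kD Cku u0 uC mG G0 GL r0 j0.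
move=> /le_trans; apply.
rewrite -[_ * K * _]mulrA [(_ * (K * _))%:E]EFinM [leRHS]muleAC; apply: lee_wpmul2l; last exact: KP.
rewrite mule_ge0 ?lee_fin//; apply: integral_ge0 => x _.
by rewrite lee_fin mulr_ge0// exprn_ge0// ltW// bump_gt0.
Qed.

(** * The Liouville argument *)

Lemma continuous_integral_eq0 (R : realType) n (f : 'rV[R]_n -> R) : (0 < n)%N ->
  continuous f -> (forall x, 0 <= f x) ->
  (\int[@lebesgue_rV R n]_x (f x)%:E <= 0)%E -> forall x, f x = 0.
Proof.
move=> n0 cf f0 If x; apply/eqP; rewrite eq_le f0 andbT leNgt; apply/negP => fx.
have mf := continuous_measurable_rV cf.
have mfE : measurable_fun setT (EFin \o f) by exact/measurable_EFinP.
have cfx : \forall y \near x, f x / 2 < f y.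
  have /cvgrPdist_lt/(_ (f x / 2)) := cf x.
  rewrite divr_gt0// => /(_ isT); apply: filterS => y.
  by rewrite ltr_norml => /andP[_]; lra.
have /nbhs_ballP[e /= e0 eP] := cfx.
pose r := e / 2; have r0 : 0 < r by rewrite divr_gt0.
pose A := [set y : 'rV[R]_n | `|1 *: y - x| <= r].
have mA : measurable A.
  rewrite (_ : A = (fun y => 1 *: y - x) @^-1` [set z | `|z| <= r])//.
  rewrite -[X in measurable X]setTI.
  by apply: measurable_affine_rV => //; exact: measurable_cube.
have lA : @lebesgue_rV R n A = ((2 * r) ^+ n)%:E.
  rewrite -(lebesgue_rV_cube n0 (ltW r0)).
  have := @lebesgue_rV_affine R n 1 (- x) [set z | `|z| <= r] ltr01 (@measurable_cube R n r).
  by rewrite expr1n mul1e.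
have fA y : A y -> f x / 2 <= f y.
  rewrite /A/= scale1r => yx; apply/ltW/eP; rewrite -ball_normE /=.
  by rewrite distrC (le_lt_trans yx)// /r ltr_pdivrMr// ltr_pMr// ltr1n.
have : ((f x / 2)%:E * ((2 * r) ^+ n)%:E <= 0)%E.
  apply: le_trans If; rewrite -lA.
  rewrite -[in leLHS](setIT A) -integral_indic// -ge0_integralZl//; last 2 first.
  - by apply/measurable_EFinP; exact: measurable_indic.
  - by rewrite lee_fin divr_ge0.
  apply: ge0_le_integral => //.
  - by move=> y _; rewrite mule_ge0// lee_fin ?divr_ge0.
  - by apply: measurable_funeM; apply/measurable_EFinP; exact: measurable_indic.
  - move=> y _; rewrite -EFinM lee_fin indicE.
    have [yA|yA] := boolP (y \in A); last by rewrite mulr0.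
    by rewrite mulr1 fA//; exact/set_mem.
by rewrite -EFinM lee_fin leNgt mulr_gt0// ?divr_gt0// exprn_gt0// mulr_gt0.
Qed.

(** For u > l, write u = u^(1-p) u^p and use that the exponent 1 - p is nonpositive. *)
Lemma powR_young (R : realType) (u l p : R) : 0 <= u -> 0 < l -> 1 <= p ->
  u <= l + l `^ (1 - p) * u `^ p.
Proof.
move=> u0 l0 p1; have [ul|lu] := leP u l.
  by rewrite (le_trans ul)// lerDl mulr_ge0// powR_ge0.
have u0' := lt_trans l0 lu.
apply: (@le_trans _ _ (u `^ (1 - p) * u `^ p)).
  by rewrite -powRD ?(gt_eqF u0') ?implybT// subrK powRr1.
apply: (@le_trans _ _ (l `^ (1 - p) * u `^ p)); last by rewrite lerDr ltW.
rewrite ler_wpM2r ?powR_ge0//; have -> : 1 - p = - (p - 1) by ring.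
by apply: powRN_le => //; [exact: ltW|rewrite subr_ge0].
Qed.

Lemma exists_powRN_le (R : realType) (b c eps r : R) : 0 < b -> 0 < eps -> 0 <= c ->
  (* At [t0] the left side equals c / (c/eps + 1), which is at most eps; the added 1 keeps the base
     positive when [c = 0]. *)
  exists2 t, r <= t & (0 < t) && (c * t `^ (- b) <= eps).
Proof.
move=> b0 e0 c0; pose t0 := (c / eps + 1) `^ (b^-1).
have ce : 0 < c / eps + 1 by rewrite ltr_wpDl// divr_ge0// ltW.
have t00 : 0 < t0 by exact: powR_gt0.
exists (Num.max r t0); first by rewrite le_max lexx.
have t1 : 0 < Num.max r t0 by rewrite lt_max t00 orbT.
rewrite t1/=; apply: (@le_trans _ _ (c * t0 `^ (- b))).
  rewrite ler_wpM2l//; apply: powRN_le => //; last exact: ltW.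
  by rewrite le_max lexx orbT.
rewrite /t0 -powRrM mulrN mulVf ?gt_eqF// powR_inv1 ?(ltW ce)//.
rewrite ler_pdivrMr// mulrDr mulrC divfK ?gt_eqF//; lra.
Qed.

Section liouville.
Context {R : realType} {n : nat} (n0 : (0 < n)%N).
Context {s p K C : R} (s01 : 0 < s) (sn : 2 * s < n%:R) {m : nat}.
Context {u : 'rV[R]_n -> R}.
Context (cu : continuous u) (u0 : forall x, 0 <= u x) (K0 : 0 <= K) (C0 : 0 <= C).

Let leb : {sigma_finite_measure set 'rV[R]_n -> \bar R} := @lebesgue_rV R n.
Let w (r : R) (x : 'rV[R]_n) := bump (r ^- 2) x ^+ m.

Context (iw : forall r, 0 < r -> (\int[leb]_x (w r x)%:E <= (C * r ^+ n)%:E)%E)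
  (iuw : forall r, 0 < r -> (\int[leb]_x (u x * w r x)%:E < +oo)%E)
  (weak : forall r, 0 < r ->
     (\int[leb]_x (u x `^ p * w r x)%:E <=
      (K * r `^ (- (2 * s)))%:E * \int[leb]_x (u x * w r x)%:E)%E).

Let mu : measurable_fun setT u. Proof. exact: continuous_measurable_rV. Qed.
Let b0 (r : R) : 0 < r -> 0 <= r ^- 2. Proof. by move=> r0; rewrite ltW// invr_gt0 exprn_gt0. Qed.
Let w0 (r : R) x : 0 < r -> 0 <= w r x.
Proof. by move=> r0; rewrite exprn_ge0// ltW// bump_gt0 ?b0. Qed.
Let w1 (r : R) x : 0 < r -> w r x <= 1.
Proof. by move=> r0; rewrite exprn_ile1// ?bump_le1 ?b0// ltW// bump_gt0 ?b0. Qed.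
Let mw (r : R) : 0 < r -> measurable_fun setT (w r).
Proof. by move=> r0; apply: measurable_funX; exact: measurable_bump (b0 r0). Qed.
Let mup : measurable_fun setT (fun x => u x `^ p).
Proof. exact: (measurableT_comp (measurable_powR p)). Qed.

(** Passing to real values loses nothing: the first integral is finite by [iuw], the second because
    the weak inequality bounds it by a multiple of the first. *)
Let A (r : R) := fine (\int[leb]_x (u x * w r x)%:E)%E.
Let J (r : R) := fine (\int[leb]_x (u x `^ p * w r x)%:E)%E.

Let A0 (r : R) : 0 < r -> 0 <= A r.
Proof.
move=> r0; apply: fine_ge0; apply: integral_ge0 => x _.
by rewrite lee_fin mulr_ge0// w0.
Qed.

Let AE (r : R) : 0 < r -> (\int[leb]_x (u x * w r x)%:E = (A r)%:E)%E.
Proof.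
move=> r0; rewrite fineK// ge0_fin_numE ?iuw//.
by apply: integral_ge0 => x _; rewrite lee_fin mulr_ge0// w0.
Qed.

Let JE (r : R) : 0 < r -> (\int[leb]_x (u x `^ p * w r x)%:E = (J r)%:E)%E.
Proof.
move=> r0; rewrite fineK// ge0_fin_numE.
  by rewrite (le_lt_trans (weak r0))// AE// -EFinM ltry.
by apply: integral_ge0 => x _; rewrite lee_fin mulr_ge0 ?powR_ge0// w0.
Qed.

Let JA (r : R) : 0 < r -> J r <= K * r `^ (- (2 * s)) * A r.
Proof. by move=> r0; have := weak r0; rewrite JE// AE// -EFinM lee_fin. Qed.

(** The weight is positive everywhere, so [u] is zero almost everywhere, and everywhere by
    continuity. *)
Let vanish (r : R) : 0 < r -> A r <= 0 -> forall x, u x = 0.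
Proof.
move=> r0 Ar x.
apply: continuous_integral_eq0 => //.
have uw0 : (\int[leb]_x `|(u x * w r x)%:E| = 0)%E.
  under eq_integral do rewrite gee0_abs ?lee_fin ?mulr_ge0// ?w0//.
  by rewrite AE//; congr EFin; apply/eqP; rewrite eq_le Ar A0.
have muw : measurable_fun setT (fun x => (u x * w r x)%:E).
  by apply/measurable_EFinP; apply: measurable_funM => //; exact: mw.
rewrite (ge0_ae_eq_integral (g := cst 0%E))//.
- by rewrite integral0.
- exact/measurable_EFinP.
- by move=> y _; rewrite lee_fin.
have := (ae_eq_integral_abs leb measurableT muw).1 uw0.
apply: filterS => y h _; have /eqP : u y * w r y = 0 by apply: EFin_inj; exact: h.
by rewrite mulf_eq0 => /orP[/eqP ->//|]; rewrite gt_eqF// exprn_gt0// bump_gt0 ?b0.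
Qed.

(** The integrals [J r] and [A r] coincide here; once K r^(-2s) <= 1/2, the finite number [A r] is
    at most its own half. *)
Lemma liouville_linear : p = 1 -> forall x, u x = 0.
Proof.
move=> p1.
have s2 : 0 < 2 * s by rewrite mulr_gt0.
have h2 : 0 < 1 / 2 :> R by lra.
have [r r1 /andP[r0 Kr]] := exists_powRN_le 1 s2 h2 K0.
apply: (vanish r0).
have JAr : J r = A r.
  by congr fine; apply: eq_integral => x _; rewrite p1 powRr1.
have := JA r0; rewrite JAr => h.
have := ler_wpM2r (A0 r0) Kr; lra.
Qed.

Section superlinear.
Context (p1 : 1 < p) (pc : p <= n%:R / (n%:R - 2 * s)).

Let young (r l : R) : 0 < r -> 0 < l ->
  A r <= l * (C * r ^+ n) + l `^ (1 - p) * J r.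
Proof.
move=> r0 l0; have lp := powR_ge0 l (1 - p).
have mwr := mw r0.
have muw : measurable_fun setT (fun x => u x `^ p * w r x) by exact: measurable_funM.
rewrite -lee_fin -AE//.
apply: (@le_trans _ _ (\int[leb]_x (l%:E * (w r x)%:E +
    (l `^ (1 - p))%:E * (u x `^ p * w r x)%:E))%E).
  apply: ge0_le_integral => //.
  - by move=> x _; rewrite lee_fin mulr_ge0// w0.
  - by apply/measurable_EFinP; exact: measurable_funM.
  - by apply: emeasurable_funD; apply: measurable_funeM; exact/measurable_EFinP.
  - move=> x _; rewrite -!EFinM -EFinD lee_fin mulrA -mulrDl ler_wpM2r ?w0//.
    exact: powR_young (u0 x) l0 (ltW p1).
rewrite ge0_integralD//; last 4 first.
- by move=> x _; rewrite mule_ge0// lee_fin ?(ltW l0)// w0.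
- by apply: measurable_funeM; exact/measurable_EFinP.
- by move=> x _; rewrite mule_ge0// lee_fin ?mulr_ge0 ?powR_ge0 ?w0.
- by apply: measurable_funeM; exact/measurable_EFinP.
rewrite ge0_integralZl//; last 3 first.
- exact/measurable_EFinP.
- by move=> x _; rewrite lee_fin w0.
- by rewrite lee_fin ltW.
rewrite ge0_integralZl//; last 2 first.
- exact/measurable_EFinP.
- by move=> x _; rewrite lee_fin mulr_ge0 ?powR_ge0 ?w0.
rewrite JE// EFinD [X in (_ <= X + _)%E]EFinM [X in (_ <= _ + X)%E]EFinM.
apply: leeD => //; apply: lee_wpmul2l; first by rewrite lee_fin ltW.
exact: iw.
Qed.

(** Here [r] is the inner radius and [t] the outer one. Applying [powR_young] to the second term of
    u w_t = u w_t w_r + u w_t (1 - w_r) gives u w_t <= u w_r + l w_t + l^(1-p) u^p (1 - w_r). The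
    term with [J r] stands on the left so that only nonnegative functions are integrated. *)
Let young_split (S r t l : R) : (\int[leb]_x (u x `^ p)%:E = S%:E)%E ->
  0 < r -> 0 < t -> 0 < l ->
  A t + l `^ (1 - p) * J r <= A r + l * (C * t ^+ n) + l `^ (1 - p) * S.
Proof.
move=> SE r0 t0 l0; have lp := powR_ge0 l (1 - p).
have [mwr mwt] := (mw r0, mw t0).
have mE (f : 'rV[R]_n -> R) : measurable_fun setT f -> measurable_fun setT (fun x => (f x)%:E).
  by move=> mf; exact/measurable_EFinP.
have mupr : measurable_fun setT (fun x => (u x `^ p * w r x)%:E).
  by apply: mE; exact: measurable_funM.
have mut : measurable_fun setT (fun x => (u x * w t x)%:E).
  by apply: mE; exact: measurable_funM.
have mur : measurable_fun setT (fun x => (u x * w r x)%:E).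
  by apply: mE; exact: measurable_funM.
have mupE := mE _ mup; have mwtE := mE _ mwt.
have ge_ur x : (0 <= (u x * w r x)%:E)%E by rewrite lee_fin mulr_ge0// w0.
have ge_ut x : (0 <= (u x * w t x)%:E)%E by rewrite lee_fin mulr_ge0// w0.
have ge_upr x : (0 <= (u x `^ p * w r x)%:E)%E by rewrite lee_fin mulr_ge0 ?powR_ge0// w0.
have ge_wt x : (0 <= (w t x)%:E)%E by rewrite lee_fin w0.
have ge_up x : (0 <= (u x `^ p)%:E)%E by rewrite lee_fin powR_ge0.
have lE : (0 <= l%:E)%E by rewrite lee_fin ltW.
have lpE : (0 <= (l `^ (1 - p))%:E)%E by rewrite lee_fin.
have h : (\int[leb]_x ((u x * w t x)%:E + (l `^ (1 - p))%:E * (u x `^ p * w r x)%:E) <=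
  \int[leb]_x ((u x * w r x)%:E + (l%:E * (w t x)%:E + (l `^ (1 - p))%:E * (u x `^ p)%:E)))%E.
  apply: ge0_le_integral => //.
  - by move=> x _; rewrite adde_ge0// mule_ge0.
  - by apply: emeasurable_funD => //; exact: measurable_funeM.
  - by apply: emeasurable_funD => //; apply: emeasurable_funD; exact: measurable_funeM.
  - move=> x _; rewrite -!EFinM -!EFinD lee_fin.
    have := powR_young (u0 x) l0 (ltW p1); set q := _ * _ `^ p => uq.
    have q0 : 0 <= q by rewrite mulr_ge0// powR_ge0.
    have -> : l `^ (1 - p) * (u x `^ p * w r x) = q * w r x by rewrite mulrA.
    have wr0 := w0 x r0; have wr1 := w1 x r0; have wt0 := w0 x t0; have wt1 := w1 x t0.
    have ux := u0 x; clearbody q.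
    move: (u x) (w r x) (w t x) q uq q0 wr0 wr1 wt0 wt1 ux.
    move=> a b c q uq q0 b0' b1 c0 c1 a0.
    have h1 : a * c * b <= a * b.
      by rewrite -mulrA ler_wpM2l// ler_piMl.
    have h2 : a * (c * (1 - b)) <= (l + q) * (c * (1 - b)).
      by rewrite ler_wpM2r// mulr_ge0// subr_ge0.
    have h3 : l * (c * (1 - b)) <= l * c.
      by rewrite ler_wpM2l ?(ltW l0)// ler_piMr// gerBl.
    have h4 : q * (c * (1 - b)) <= q * (1 - b).
      by rewrite ler_wpM2l// ler_piMl// subr_ge0.
    lra.
move: h; rewrite ge0_integralD//; last 2 first.
- by move=> x _; rewrite mule_ge0.
- exact: measurable_funeM.
rewrite ge0_integralZl// [leRHS]ge0_integralD//; last 2 first.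
- by move=> x _; rewrite adde_ge0// mule_ge0.
- by apply: emeasurable_funD; exact: measurable_funeM.
rewrite [X in (_ <= _ + X)%E]ge0_integralD//; last 4 first.
- by move=> x _; rewrite mule_ge0.
- exact: measurable_funeM.
- by move=> x _; rewrite mule_ge0.
- exact: measurable_funeM.
rewrite [in leRHS]ge0_integralZl// ge0_integralZl// SE !AE// JE// => h.
rewrite -lee_fin -addrA !EFinD !(EFinM (l `^ _)).
apply: (le_trans h); apply: leeD => //; apply: leeD => //.
by rewrite EFinM; apply: lee_wpmul2l => //; exact: iw.
Qed.

Let al := 2 * s / (p - 1).

Let scaling1 (L t : R) : 0 < L -> 0 < t ->
  t `^ (- (2 * s)) * (L * t `^ (- al)) `^ (1 - p) = L `^ (1 - p).
Proof.
move=> L0 t0; rewrite powRM ?powR_ge0 ?(ltW L0)// -powRrM mulrCA -powRD.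
  have -> : - (2 * s) + - al * (1 - p) = 0.
    by rewrite /al; field; rewrite subr_eq0 gt_eqF.
  by rewrite powRr0 mulr1.
by rewrite (gt_eqF t0) implybT.
Qed.

(** The total power of t is n - 2s - 2s/(p-1), and its being nonpositive amounts to (n - 2s)(p - 1)
    <= 2s, that is, to the bound on [p]. *)
Let scaling2 (L t : R) : 0 < L -> 1 <= t ->
  t `^ (- (2 * s)) * (L * t `^ (- al) * (C * t ^+ n)) <= C * L.
Proof.
move=> L0 t1; have t0 : 0 < t := lt_le_trans ltr01 t1.
rewrite -powR_mulrn ?(ltW t0)//.
have -> : t `^ (- (2 * s)) * (L * t `^ (- al) * (C * t `^ n%:R)) =
    C * L * t `^ (n%:R - (2 * s + al)).
  rewrite (_ : n%:R - (2 * s + al) = - (2 * s) + - al + n%:R); last by ring.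
  by rewrite !powRD ?(gt_eqF t0) ?implybT//; ring.
rewrite ler_piMr ?mulr_ge0 ?(ltW L0)//.
suff E : n%:R - (2 * s + al) <= 0 by have := ler_powR t1 E; rewrite powRr0.
rewrite subr_le0.
have p0 : 0 < p - 1 by rewrite subr_gt0.
have ns : 0 < n%:R - 2 * s by rewrite subr_gt0.
have : (n%:R - 2 * s) * (p - 1) <= 2 * s.
  by move: pc; rewrite ler_pdivlMr//; lra.
rewrite -ler_pdivlMr// => h.
have -> : al = 2 * s / (p - 1) by [].
by move: h; set q := 2 * s / _; lra.
Qed.

Lemma liouville_superlinear : forall x, u x = 0.
Proof.
have s2 : 0 < 2 * s by rewrite mulr_gt0.
have p0 : 0 < p - 1 by rewrite subr_gt0.
have h2 : 0 < 1 / 2 :> R by lra.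
have up0 x : 0 <= u x `^ p by exact: powR_ge0.
(* [B] is the part of the bound on [A t] that is still multiplied by t^(-2s) after the weak
   inequality; the rest has been scaled away. *)
have bnd (L t B : R) : 0 < L -> 1 <= t ->
    A t <= B + L * t `^ (- al) * (C * t ^+ n) -> J t <= K * t `^ (- (2 * s)) * B + K * (C * L).
  move=> L0 t1 AB; have t0 : 0 < t := lt_le_trans ltr01 t1.
  apply: (le_trans (JA t0)); have tp := powR_ge0 t (- (2 * s)).
  have := ler_wpM2l (mulr_ge0 K0 tp) AB => /le_trans; apply.
  rewrite mulrDr lerD2l -mulrA ler_wpM2l//; exact: scaling2.
have [S SE] : exists S, (\int[leb]_x (u x `^ p)%:E = S%:E)%E.
  (* With K L^(1-p) <= 1/2 the term in [J t] is absorbed by the left side, [J t] being finite; what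
     is left is a bound uniform in t >= 1. *)
  have [L L1 /andP[L0 KL]] := exists_powRN_le 1 p0 h2 K0.
  exists (fine (\int[leb]_x (u x `^ p)%:E)%E); rewrite fineK// ge0_fin_numE; last first.
    by apply: integral_ge0 => x _; rewrite lee_fin.
  apply: (@le_lt_trans _ _ (2 * (K * (C * L)))%:E); last exact: ltry.
  apply: (@integral_bump_sup _ _ _ m 1) => // t t1.
  have t0 : 0 < t := lt_le_trans ltr01 t1.
  rewrite -/(w t _) -/leb JE// lee_fin.
  have l0 : 0 < L * t `^ (- al) by rewrite mulr_gt0// powR_gt0.
  have := young t0 l0; rewrite addrC => /(bnd L t _ L0 t1).
  rewrite -mulrA (mulrA (t `^ _)) scaling1// opprB in KL *.
  have J0 : 0 <= J t.
    by apply: fine_ge0; apply: integral_ge0 => x _; rewrite lee_fin mulr_ge0// w0.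
  have := ler_wpM2r J0 KL; rewrite mulrA; lra.
have S0 : 0 <= S.
  by rewrite -lee_fin -SE; apply: integral_ge0 => x _; rewrite lee_fin.
have JS t : 0 < t -> J t <= S.
  move=> t0; rewrite -lee_fin -SE -JE//; apply: ge0_le_integral => //.
  - by move=> x _; rewrite lee_fin mulr_ge0// w0.
  - by apply/measurable_EFinP; apply: measurable_funM => //; exact: mw.
  - exact/measurable_EFinP.
  - by move=> x _; rewrite lee_fin ler_piMr// w1.
have SL L : 0 < L -> S <= L * (K * C + 2).
  move=> L0; have LP := powR_ge0 L (1 - p).
  have c0 : 0 < K * L `^ (1 - p) + 1 by rewrite ltr_wpDl// mulr_ge0.
  (* The tolerated tail S - J r: multiplied by K L^(1-p) it costs at most [L]. *)
  pose e1 := L / (K * L `^ (1 - p) + 1).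
  have e0 : 0 < e1 by rewrite divr_gt0.
  have Ke1 : K * L `^ (1 - p) * e1 <= L.
    by rewrite /e1 mulrA ler_pdivrMr// mulrC ler_wpM2l ?(ltW L0)// lerDl.
  (* Otherwise [J t] stays below S - e1 for all t >= 1, and so does its supremum [S]. *)
  have [r [r1 Jr]] : exists r, 1 <= r /\ S - e1 <= J r.
    apply: contrapT => H.
    have : (\int[leb]_x (u x `^ p)%:E <= (S - e1)%:E)%E.
      apply: (@integral_bump_sup _ _ _ m 1) => // t t1.
      rewrite -/(w t _) -/leb JE ?(lt_le_trans ltr01)// lee_fin leNgt.
      by apply/negP => Jt; apply: H; exists t; split => //; exact: ltW.
    by rewrite SE lee_fin; lra.
  have r0 : 0 < r := lt_le_trans ltr01 r1.
  (* With [r] now fixed, the term K A(r) t^(-2s) costs at most another [L] beyond [t0]. *)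
  have [t0 t01 /andP[t00 Kt0]] := exists_powRN_le 1 s2 L0 (mulr_ge0 K0 (A0 r0)).
  rewrite -lee_fin -SE; apply: (@integral_bump_sup _ _ _ m t0) => // t tt0.
  have t1 : 1 <= t := le_trans t01 tt0.
  have tp : 0 < t := lt_le_trans ltr01 t1.
  rewrite -/(w t _) -/leb JE// lee_fin.
  have l0 : 0 < L * t `^ (- al) by rewrite mulr_gt0// powR_gt0.
  have ys := young_split SE r0 tp l0.
  have := @bnd L t (A r + (L * t `^ (- al)) `^ (1 - p) * (S - J r)) L0 t1.
  have E : K * t `^ (- (2 * s)) * (A r + (L * t `^ (- al)) `^ (1 - p) * (S - J r)) =
      K * A r * t `^ (- (2 * s)) + K * L `^ (1 - p) * (S - J r).
    by rewrite -(scaling1 L0 tp); ring.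
  rewrite E => h.
  have {}h : J t <= K * A r * t `^ (- (2 * s)) + K * L `^ (1 - p) * (S - J r) + K * (C * L).
    by apply: h; lra.
  have h5 : K * A r * t `^ (- (2 * s)) <= L.
    apply: le_trans Kt0; rewrite ler_wpM2l ?mulr_ge0 ?A0//.
    by apply: powRN_le => //; exact: ltW.
  have h6 : K * L `^ (1 - p) * (S - J r) <= K * L `^ (1 - p) * e1.
    by rewrite ler_wpM2l ?mulr_ge0//; lra.
  lra.
have SN : S <= 0.
  rewrite leNgt; apply/negP => Sp.
  have c0 : 0 < K * C + 2 by rewrite ltr_wpDl// mulr_ge0.
  (* For this [L] the bound reads S <= S/2. *)
  have := SL (S / (K * C + 2) / 2); rewrite divr_gt0 ?divr_gt0// => /(_ isT).
  by rewrite mulrAC divfK ?gt_eqF//; lra.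
apply: (vanish ltr01).
have J1 : J 1 <= 0 := le_trans (JS 1 ltr01) SN.
(* As [J 1] is nonpositive, [young] at radius 1 leaves a multiple of [l], which is arbitrarily
   small. *)
apply/ler_addgt0Pr => e e0; rewrite add0r.
have c0 : 0 < C * 1 ^+ n + 1 by rewrite ltr_wpDl// mulr_ge0// exprn_ge0.
pose l := e / (C * 1 ^+ n + 1).
have l0 : 0 < l by rewrite divr_gt0.
have := young ltr01 l0; have := powR_ge0 l (1 - p).
have : l * (C * 1 ^+ n) <= e.
  by rewrite /l mulrAC ler_pdivrMr// ler_wpM2l ?(ltW e0)// lerDl.
nra.
Qed.

End superlinear.

End liouville.

(** * Reduction to a bounded kernel *)

Lemma measurable_sphere (R : realType) n : measurable (@sphere R n).
Proof.
rewrite (_ : @sphere R n = @enorm R n @^-1` [set 1]).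
  by rewrite -[X in measurable X]setTI; exact: measurable_enorm.
by apply/seteqP; split.
Qed.

Lemma sphere_direction (R : realType) n (y : 'rV[R]_n) : y != 0 ->
  sphere ((enorm y)^-1 *: y).
Proof.
by move=> y0; rewrite /sphere/= enormZ ger0_norm ?invr_ge0 ?enorm_ge0// mulVf// enorm_eq0.
Qed.

Section kernel.
Context {R : realType} {n : nat} (n0 : (0 < n)%N).
Context {a : 'rV[R]_n -> R} {c D : R} (c0 : 0 < c) (D0 : 0 <= D).
Context (ma : measurable_fun (@sphere R n) a)
  (aD : \forall theta \ae @surface_measure R n, sphere theta -> 0 <= a theta <= D).

(** The bounds on [a] hold almost everywhere and its measurability is known on the sphere. Clamping
    to [0, D] and extending by 0 off the sphere yields a kernel measurable on the whole space and
    bounded at every point, as the weak inequality asks. *)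
Let clamp (t : 'rV[R]_n) : R := Num.min (Num.max (a t) 0) D.

Definition clamped_kernel (y : 'rV[R]_n) : R :=
  (enorm y `^ c)^-1 * (clamp \_ (@sphere R n)) ((enorm y)^-1 *: y).

Let measurable_enorm_powRV : measurable_fun setT (fun y : 'rV[R]_n => (enorm y `^ c)^-1).
Proof.
under eq_fun do rewrite -powRN.
by apply: (measurableT_comp (measurable_powR (- c))); exact: measurable_enorm.
Qed.

Lemma measurable_clamped_kernel : measurable_fun setT clamped_kernel.
Proof.
apply: measurable_funM => //.
apply: (measurableT_comp _ (@measurable_direction R n)).
apply/(measurable_restrictT _ (@measurable_sphere R n)).
by apply: measurable_minr => //; exact: measurable_maxr.
Qed.

Lemma clamped_kernel_bounds y : 0 <= clamped_kernel y <= D * `|y| `^ (- c).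
Proof.
have cl t : 0 <= (clamp \_ (@sphere R n)) t <= D.
  by rewrite patchE; case: ifPn => _; rewrite ?lexx//= le_min le_max lexx orbT D0 ge_min lexx orbT.
have /andP[cl0 clD] := cl ((enorm y)^-1 *: y).
rewrite mulr_ge0 ?invr_ge0 ?powR_ge0//= mulrC ler_pM ?invr_ge0 ?powR_ge0// powRN.
have [->|y0] := eqVneq y 0.
  have -> : enorm (0 : 'rV[R]_n) = 0 by apply/eqP; rewrite enorm_eq0.
  by rewrite normr0.
rewrite lef_pV2 ?posrE ?powR_gt0 ?enorm_gt0 ?normr_gt0//.
by apply: ge0_ler_powR; rewrite ?nnegrE ?enorm_ge0 ?norm_le_enorm// ltW.
Qed.

(** The integrands agree at almost every nonzero [y], because [ae_direction] carries the bounds on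
    [a] from directions to vectors, and at [y = 0], where the second difference vanishes. *)
Lemma stable_op_clamped_kernel (s : R) (u : 'rV[R]_n -> R) x :
  c = n%:R + 2 * s -> measurable_fun setT u ->
  stable_op s a u x = \int[@lebesgue_rV R n]_y (second_difference u x y * clamped_kernel y).
Proof.
move=> cE mu; rewrite /stable_op /Rintegral -cE; congr fine.
have sd0 : second_difference u x 0 = 0 by rewrite /second_difference subr0 addr0; ring.
have mr : measurable_fun setT (a \_ (@sphere R n)).
  exact/(measurable_restrictT _ (@measurable_sphere R n)).
have msd : measurable_fun setT (second_difference u x).
  have xD : measurable_fun setT (fun y : 'rV[R]_n => u (x + y)).
    by under eq_fun do rewrite addrC; exact: measurable_shift_rV.
  have xB : measurable_fun setT (fun y : 'rV[R]_n => u (x - y)).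
    apply: (measurableT_comp mu); apply: measurable_rVP => i.
    by under eq_fun do rewrite !mxE; apply: measurable_funB => //; exact: measurable_coord_rV.
  by apply: measurable_funB => //; exact: measurable_funD.
(* Restricting [a] to the sphere makes the integrand measurable without changing it: the normalized
   vector leaves the sphere only at [y = 0]. *)
transitivity (\int[@lebesgue_rV R n]_y (second_difference u x y * (enorm y `^ c)^-1 *
    (a \_ (@sphere R n)) ((enorm y)^-1 *: y))%:E)%E.
  apply: eq_integral => y _; congr EFin.
  rewrite -/(second_difference u x y).
  have [->|y0] := eqVneq y 0; first by rewrite sd0 !mul0r.
  by rewrite patchE mem_set//; exact: sphere_direction.
apply: ae_eq_integral => //.
- apply/measurable_EFinP; apply: measurable_funM; first exact: measurable_funM.
  exact: (measurableT_comp mr (@measurable_direction R n)).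
- apply/measurable_EFinP; apply: measurable_funM => //.
  exact: measurable_clamped_kernel.
have := ae_direction n0 aD; apply: filterS => y yP _; congr EFin.
have [->|y0] := eqVneq y 0; first by rewrite sd0 !mul0r.
rewrite /clamped_kernel -mulrA; congr (_ * (_ * _)).
rewrite !patchE mem_set; last exact: sphere_direction.
have /andP[ay0 ayD] := yP y0.
by rewrite /clamp max_l// min_l.
Qed.

End kernel.

Theorem theorem5p1 (R : realType) (N : nat) (s : R) (a : 'rV[R]_N -> R)
    (d D : R) (nu0 : 'rV[R]_N) (tau0 p : R) (u : 'rV[R]_N -> R)
    (hN : (2 <= N)%N)
    (hs : 0 < s < 1)
    (ha : Linfty_sphere a)
    (ha_even : \forall theta \ae @surface_measure R N,
       sphere theta -> a (- theta) = a theta)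
    (hd : 0 < d) (hdD : d < D)
    (hnu0 : sphere nu0)
    (htau0 : 0 < tau0 <= 1)
    (ha_bounds : \forall theta \ae @surface_measure R N,
       sphere theta -> 0 <= a theta <= D)
    (ha_cone : \forall theta \ae @surface_measure R N,
       (cone nu0 tau0 0 `&` @sphere R N) theta -> d <= a theta)
    (hp : 1 <= p <= N%:R / (N%:R - 2 * s))
    (hu_C2 : Ck 2 u)
    (hu_Ls : space_Ls s u)
    (hu_ge0 : forall x, 0 <= u x)
    (hu_sol : forall x, u x `^ p <= - stable_op s a u x) :
  forall x, u x = 0.
Proof.
have N0 : (0 < N)%N by exact: leq_trans hN.
have /andP[s0 s1] := hs; have /andP[p1 pN] := hp.
have N2 : 2 <= N%:R :> R by rewrite (ler_nat R 2).
have s2N : 2 * s < N%:R by lra.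
have D0 : 0 <= D by rewrite ltW// (lt_trans hd).
have c0 : 0 < N%:R + 2 * s by lra.
have cu : continuous u by case: hu_C2.
have mu := continuous_measurable_rV cu.
have [sigma [C [ss C0 uC]]] := space_Ls_growth cu hu_Ls.
have ma : measurable_fun (@sphere R N) a by case: ha.
pose k := @clamped_kernel R N a (N%:R + 2 * s) D.
have mk : measurable_fun setT k by exact: measurable_clamped_kernel.
have kD y : 0 <= k y <= D * `|y| `^ (- (N%:R + 2 * s)) by exact: clamped_kernel_bounds.
have up0 x : 0 <= u x `^ p by exact: powR_ge0.
have mup : measurable_fun setT (fun x => u x `^ p).
  exact: (measurableT_comp (measurable_powR p)).
have sol x : u x `^ p <= - \int[@lebesgue_rV R N]_y (second_difference u x y * k y).
  by have <- := stable_op_clamped_kernel N0 ma ha_bounds x (erefl (N%:R + 2 * s)) mu.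
have [K K0 weak] := weak_supersolution hN hs ss C0 D0 mk kD hu_C2 hu_ge0 uC mup up0 sol.
have N_lt : (N + 2 < 2 * N.+2)%N.
  by rewrite addn2 mul2n -addnn -[X in (X < _)%N]addn0 ltn_add2l.
have N_lt' : (N < 2 * N.+2)%N by apply: leq_trans N_lt; rewrite ltnS leq_addr.
have [C1 C10 iw] := @integral_bump_pow R N N0 N.+2 N_lt'.
have sig2 : 0 <= sigma <= 2 by case/andP: ss => -> /= ?; lra.
have uC' x : u x <= C * (1 + `|x|) `^ sigma by rewrite -(ger0_norm (hu_ge0 x)).
have iuw r : 0 < r ->
    (\int[@lebesgue_rV R N]_x (u x * bump (r ^- 2) x ^+ N.+2)%:E < +oo)%E.
  exact: (integral_growth_bump_lty N0 N_lt sig2 C0 mu hu_ge0 uC').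
have [p1'|p1'] := eqVneq p 1.
  exact: (liouville_linear N0 s0 cu hu_ge0 K0 iuw weak p1').
have p1lt : 1 < p by rewrite lt_neqAle eq_sym p1'.
exact: (liouville_superlinear N0 s0 s2N cu hu_ge0 K0 C10 iw iuw weak p1lt pN).
Qed.
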